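(* Let $r\ge1$ be an integer. For each of the following six choices of $m$ and of multisets $\mathcal{S}_t$ depending on $t\in(1,\infty)$ (where $\mathrm{i}=\sqrt{-1}$ and $(\alpha,1)^{r}$ denotes $r$ copies of $(\alpha,1)$), the family $\{\mu_{\mathcal{S}_t}\}_{t>1}$ is a one-parameter family of pairwise non-isomorphic indecomposable $2$-step nilpotent Lie algebras of type $(2,m)$ which do not admit any nilsoliton metric: 1. $m=8+2r$, $\mathcal{S}_t=\{(\mathrm{i}t,1),(0,2),(1,1)^{r}\}$. 2. $m=11+2r$, $\mathcal{S}_t=\{(\mathrm{i}t,1),(0,2),(1,1)^{r},1\}$. 3. $m=8+4r$, $\mathcal{S}_t=\{(\mathrm{i}t,2),(\mathrm{i},1)^{r}\}$. 4. $m=8+4r+5$, $\mathcal{S}_t=\{(\mathrm{i}t,2),(\mathrm{i},1)^{r},(0,1),1\}$. 5. $m=8+4r+2$, $\mathcal{S}_t=\{(\mathrm{i}t,2),(\mathrm{i},1)^{r},(0,1)\}$. 6. $m=8+4r+3$, $\mathcal{S}_t=\{(\mathrm{i}t,2),(\mathrm{i},1)^{r},1\}$.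
   Context: Let $\mathfrak{n}=\mathfrak{n}_1\oplus\mathfrak{n}_2$ be a real inner product space with $\mathfrak{n}_1\perp\mathfrak{n}_2$ and orthonormal bases $\{X_1,\dots,X_m\}$ of $\mathfrak{n}_1$, $\{Z_1,Z_2\}$ of $\mathfrak{n}_2$. A bilinear skew-symmetric map $\mu:\mathfrak{n}_1\times\mathfrak{n}_1\to\mathfrak{n}_2$ is regarded as a $2$-step nilpotent Lie bracket on $\mathfrak{n}$ (with $\mathfrak{n}_2$ central); it is of type $(2,m)$ if $\mu(\mathfrak{n}_1,\mathfrak{n}_1)=\mathfrak{n}_2$. It is determined by $J_\mu:\mathfrak{n}_2\to\mathfrak{so}(\mathfrak{n}_1)$, $\langle J_\mu(Z)X,Y\rangle=\langle\mu(X,Y),Z\rangle$. Isomorphic means isomorphic as Lie algebras; indecomposable means not a direct sum of two nonzero ideals. Definition of $\mu_{\mathcal{S}}$: here $\mathcal{S}$ is a multiset whose elements are pairs $(\alpha,k)$ with $\alpha\in\mathbb{C}$, $k\ge1$ an integer, and single positive integers $\epsilon$. The matrix of $J_{\mu_{\mathcal{S}}}(xZ_1+yZ_2)$ with respect to $\{X_i\}$ is block diagonal with one diagonal block $\begin{bmatrix} 0 & A \\ -A^t & 0 \end{bmatrix}$ for each element of $\mathcal{S}$, where $A$ is as follows. - For $(a,k)$ with $a\in\mathbb{R}$: $A$ is $k\times k$ with $A_{ij}=y-ax$ if $i+j=k+1$, $A_{ij}=x$ if $i+j=k+2$, and $0$ otherwise (whole block $2k\times2k$). - For $(a+\mathrm{i}b,k)$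 with $a,b\in\mathbb{R}$, $b\neq0$: $A$ is $2k\times2k$, partitioned into $2\times2$ blocks $A_{ij}$, $1\le i,j\le k$, with $A_{ij}=\begin{bmatrix} -bx & y-ax \\ y-ax & bx \end{bmatrix}$ if $i+j=k+1$, $A_{ij}=\begin{bmatrix} 0 & x \\ x & 0 \end{bmatrix}$ if $i+j=k+2$, and $0$ otherwise (whole block $4k\times4k$). - For $\epsilon$: $A$ has $\epsilon+1$ rows and $\epsilon$ columns, with $A_{ii}=y$, $A_{i+1,i}=x$ for $1\le i\le\epsilon$, and $0$ otherwise (whole block $(2\epsilon+1)\times(2\epsilon+1)$). A nilsoliton metric for $(\mathfrak{n},\mu)$ is an inner product on $\mathfrak{n}$ such that the corresponding left-invariant Riemannian metric $g$ on the simply connected nilpotent Lie group with Lie algebra $(\mathfrak{n},\mu)$ is a Ricci soliton, i.e. the Ricci flow solution starting at $g$ evolves only by time-dependent scaling and pull-back by diffeomorphisms; in this setting this is known to be equivalent to: the Ricci operator of $g$ equals $cI+D$ for some $c\in\mathbb{R}$ and some derivation $D$ of $(\mathfrak{n},\mu)$. *)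

(* Defs.v *)
From HB Require Import structures.
From mathcomp Require Import all_boot all_order all_algebra.
From mathcomp Require Import reals complex ring lra.

Set Implicit Arguments.
Unset Strict Implicit.
Unset Printing Implicit Defensive.

Import Order.TTheory GRing.Theory Num.Theory.
Local Open Scope ring_scope.

(* Real Lie algebras are carried by row vectors 'rV[R]_n, with an explicit    *)
(* bracket; endomorphisms and subspaces are {linear _ -> _} and {vspace _}.   *)

Section LieAlgebra.
Variable R : realType.

Definition bilinear_map n p (f : 'rV[R]_n -> 'rV[R]_n -> 'rV[R]_p) : Prop :=
  (forall x, linear (f x)) /\ (forall y, linear (f^~ y)).

Definition lie_bracket n (br : 'rV[R]_n -> 'rV[R]_n -> 'rV[R]_n) : Prop :=
  [/\ bilinear_map br,
      forall x, br x x = 0 &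
      forall x y z, br x (br y z) + br y (br z x) + br z (br x y) = 0].

Definition two_step_nilpotent n (br : 'rV[R]_n -> 'rV[R]_n -> 'rV[R]_n) : Prop :=
  (exists x y, br x y != 0) /\ (forall x y z, br x (br y z) = 0).

Definition lie_isomorphic n1 n2
    (br1 : 'rV[R]_n1 -> 'rV[R]_n1 -> 'rV[R]_n1)
    (br2 : 'rV[R]_n2 -> 'rV[R]_n2 -> 'rV[R]_n2) : Prop :=
  exists2 f : {linear 'rV[R]_n1 -> 'rV[R]_n2},
    bijective f & forall x y, f (br1 x y) = br2 (f x) (f y).

Definition lie_ideal n (br : 'rV[R]_n -> 'rV[R]_n -> 'rV[R]_n)
    (U : {vspace 'rV[R]_n}) : Prop :=
  forall x u, u \in U -> br x u \in U.

Definition indecomposable n (br : 'rV[R]_n -> 'rV[R]_n -> 'rV[R]_n) : Prop :=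
  ~ exists U V : {vspace 'rV[R]_n},
      [/\ lie_ideal br U /\ lie_ideal br V,
          U != 0%VS /\ V != 0%VS,
          (U + V)%VS = fullv & (U :&: V)%VS = 0%VS].

Definition derivation n (br : 'rV[R]_n -> 'rV[R]_n -> 'rV[R]_n)
    (D : 'rV[R]_n -> 'rV[R]_n) : Prop :=
  forall x y, D (br x y) = br (D x) y + br x (D y).

(* Geometry of the left-invariant metric induced by an inner product ip on    *)
(* the Lie algebra.  Everything is evaluated on left-invariant vector fields: *)
(* for these, ip of two fields is constant, which is why the compatibility    *)
(* with the metric has no derivative term.                                    *)

Definition levi_civita n (br : 'rV[R]_n -> 'rV[R]_n -> 'rV[R]_n)
    (ip : {dot 'rV[R]_n for idfun}) (nabla : 'rV[R]_n -> 'rV[R]_n -> 'rV[R]_n) :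
    Prop :=
  [/\ bilinear_map nabla,
      forall x y, nabla x y - nabla y x = br x y &
      forall x y z, ip (nabla x y) z + ip y (nabla x z) = 0].

Definition curvature n (br nabla : 'rV[R]_n -> 'rV[R]_n -> 'rV[R]_n)
    (x y z : 'rV[R]_n) : 'rV[R]_n :=
  nabla x (nabla y z) - nabla y (nabla x z) - nabla (br x y) z.

Definition ricci_tensor n (br nabla : 'rV[R]_n -> 'rV[R]_n -> 'rV[R]_n)
    (y z : 'rV[R]_n) : R :=
  \tr (lin1_mx (fun x => curvature br nabla x y z)).

Definition ricci_operator n (br : 'rV[R]_n -> 'rV[R]_n -> 'rV[R]_n)
    (ip : {dot 'rV[R]_n for idfun}) (Ric : 'rV[R]_n -> 'rV[R]_n) : Prop :=
  exists2 nabla, levi_civita br ip nabla &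
    forall y z, ip (Ric y) z = ricci_tensor br nabla y z.

(* Algebraic form of the Ricci soliton condition, equivalent to it for        *)
(* left-invariant metrics on simply connected nilpotent Lie groups.           *)
Definition nilsoliton n (br : 'rV[R]_n -> 'rV[R]_n -> 'rV[R]_n)
    (ip : {dot 'rV[R]_n for idfun}) : Prop :=
  exists Ric, ricci_operator br ip Ric /\
    exists (c : R) (D : {linear 'rV[R]_n -> 'rV[R]_n}),
      derivation br D /\ forall x, Ric x = c *: x + D x.

(* A map mu : n1 x n1 -> n2, with dim n1 = d1 and dim n2 = d2, is of type     *)
(* (p, q) when d2 = p and d1 = q; mu(n1, n1) is understood as a linear span.  *)
Definition of_type (p q d1 d2 : nat)
    (mu : 'rV[R]_d1 -> 'rV[R]_d1 -> 'rV[R]_d2) : Prop :=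
  [/\ d2 = p /\ d1 = q,
      bilinear_map mu,
      forall X Y, mu X Y = - mu Y X &
      forall W : {vspace 'rV[R]_d2}, (forall X Y, mu X Y \in W) -> W = fullv].

(* n = n1 (+) n2, with n2 central.                                            *)
Definition bracket_of d1 d2 (mu : 'rV[R]_d1 -> 'rV[R]_d1 -> 'rV[R]_d2)
    (u v : 'rV[R]_(d1 + d2)) : 'rV[R]_(d1 + d2) :=
  row_mx 0 (mu (lsubmx u) (lsubmx v)).

End LieAlgebra.

Section MuS.
Variable R : realType.

Inductive elt : Type :=
  | Pair of R[i] & nat
  | Eps of nat.

Definition blk_rows (s : elt) : nat :=
  match s with
  | Pair (_ +i* b)%C k => if b == 0 then k else (2 * k)%N
  | Eps e => e.+1
  end.

Definition blk_cols (s : elt) : nat :=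
  match s with
  | Pair (_ +i* b)%C k => if b == 0 then k else (2 * k)%N
  | Eps e => e
  end.

(* Entries of the matrix A attached to an element, for J(x Z_1 + y Z_2).      *)
(* Indices i, j start at 0, so the conditions i + j = k + 1 and i + j = k + 2 *)
(* on 1-based indices become (i + j).+1 = k and i + j = k.                    *)
Definition real_entry (a : R) (k : nat) (x y : R) (i j : nat) : R :=
  if (i + j).+1 == k then y - a * x else if (i + j)%N == k then x else 0.

(* The 2 x 2 block containing (i, j) is (i./2, j./2), and the position inside *)
(* that block is (odd i, odd j).                                              *)
Definition complex_entry (a b : R) (k : nat) (x y : R) (i j : nat) : R :=
  if (i./2 + j./2).+1 == k then
    match odd i, odd j with
    | false, false => - (b * x)
    | true, true => b * x
    | _, _ => y - a * x
    end
  else if (i./2 + j./2)%N == k then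
    if odd i == odd j then 0 else x
  else 0.

Definition eps_entry (x y : R) (i j : nat) : R :=
  if i == j then y else if i == j.+1 then x else 0.

Definition blk_entry (s : elt) : R -> R -> nat -> nat -> R :=
  match s with
  | Pair (a +i* b)%C k => if b == 0 then real_entry a k else complex_entry a b k
  | Eps _ => eps_entry
  end.

Definition blk_A (s : elt) (x y : R) : 'M[R]_(blk_rows s, blk_cols s) :=
  \matrix_(i, j) blk_entry s x y i j.

Definition blk_J (s : elt) (x y : R) : 'M[R]_(blk_rows s + blk_cols s) :=
  block_mx 0 (blk_A s x y) (- (blk_A s x y)^T) 0.

(* A multiset is given by a list of its elements; the order only permutes the *)
(* orthonormal basis of n1.                                                   *)
Fixpoint dim_n1 (S : seq elt) : nat :=
  if S is s :: S' then (blk_rows s + blk_cols s + dim_n1 S')%N else 0%N.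

Fixpoint J_mx (S : seq elt) (x y : R) : 'M[R]_(dim_n1 S) :=
  match S with
  | [::] => 0
  | s :: S' => block_mx (blk_J s x y) 0 0 (J_mx S' x y)
  end.

(* The matrix of J acts on coordinate columns.  The coordinates of mu(X, Y)   *)
(* on Z_1, Z_2 are <J(Z_1) X, Y> and <J(Z_2) X, Y>; see mu_SE.                *)
Definition mu_S (S : seq elt) (X Y : 'rV[R]_(dim_n1 S)) : 'rV[R]_2 :=
  \row_(k < 2)
    (Y *m J_mx S (if k == 0 then 1 else 0) (if k == 0 then 0 else 1) *m X^T) 0 0.

Definition br_S (S : seq elt) :
    'rV[R]_(dim_n1 S + 2) -> 'rV[R]_(dim_n1 S + 2) -> 'rV[R]_(dim_n1 S + 2) :=
  bracket_of (@mu_S S).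

Definition nonsoliton_family (m : nat) (S : R -> seq elt) : Prop :=
  (forall t, 1 < t ->
     [/\ of_type 2 m (@mu_S (S t)),
         lie_bracket (@br_S (S t)) /\ two_step_nilpotent (@br_S (S t)),
         indecomposable (@br_S (S t)) &
         ~ exists ip, nilsoliton (@br_S (S t)) ip]) /\
  (forall s t, 1 < s -> 1 < t -> s != t ->
     ~ lie_isomorphic (@br_S (S s)) (@br_S (S t))).

End MuS.

Section Checks.
Variable R : realType.

Lemma blk_entryD (s : elt R) (x y : R) (i j : nat) :
  blk_entry s x y i j = x * blk_entry s 1 0 i j + y * blk_entry s 0 1 i j.
Proof.
case: s => [[a b] k|e] /=; last first.
  by rewrite /eps_entry; case: (i == j); case: (i == j.+1); ring.
case: (b == 0); rewrite /real_entry /complex_entry.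
  by case: ((i + j).+1 == k)%N; case: (i + j == k)%N; ring.
by case: ((i./2 + j./2).+1 == k)%N; case: (i./2 + j./2 == k)%N;
  case: (odd i); case: (odd j) => /=; ring.
Qed.

Lemma blk_JD (s : elt R) (x y : R) :
  blk_J s x y = x *: blk_J s 1 0 + y *: blk_J s 0 1.
Proof.
have EA : blk_A s x y = x *: blk_A s 1 0 + y *: blk_A s 0 1.
  by apply/matrixP => i j; rewrite !mxE blk_entryD.
rewrite /blk_J EA linearD !linearZ /=.
by rewrite !scale_block_mx add_block_mx !scaler0 !addr0 opprD !scalerN.
Qed.

Lemma J_mxD (S : seq (elt R)) (x y : R) :
  J_mx S x y = x *: J_mx S 1 0 + y *: J_mx S 0 1.
Proof.
elim: S => [|s S IH] /=; first by rewrite !scaler0 addr0.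
rewrite IH blk_JD; move: (blk_J s 1 0) (blk_J s 0 1) => B C.
by rewrite !scale_block_mx add_block_mx !scaler0 !addr0.
Qed.

Lemma blk_J_skew (s : elt R) (x y : R) : (blk_J s x y)^T = - blk_J s x y.
Proof.
rewrite /blk_J; move: (blk_A s x y) => A.
by rewrite tr_block_mx opp_block_mx !trmx0 !oppr0 opprK linearN /= trmxK.
Qed.

Lemma J_mx_skew (S : seq (elt R)) (x y : R) : (J_mx S x y)^T = - J_mx S x y.
Proof.
elim: S => [|s S IH] /=; first by rewrite trmx0 oppr0.
rewrite tr_block_mx IH blk_J_skew !trmx0; move: (blk_J s x y) => B.
by rewrite opp_block_mx !oppr0.
Qed.

(* <J(z) X, Y> = <mu(X, Y), z> for the standard inner products. *)
Lemma mu_SE (S : seq (elt R)) (X Y : 'rV[R]_(dim_n1 S)) (z : 'rV[R]_2) :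
  ((J_mx S (z 0 0) (z 0 1) *m X^T)^T *m Y^T) 0 0 = (mu_S X Y *m z^T) 0 0.
Proof.
rewrite -trmx_mul mulmxA mxE J_mxD mulmxDr mulmxDl -!scalemxAr -!scalemxAl.
by rewrite !mxE !big_ord_recl big_ord0 !mxE /= addr0 !(mulrC (z _ _));
  congr (_ * z _ _ + _ * z _ _); apply/val_inj.
Qed.

Section LeviCivita.
Variables (n : nat) (ip : {dot 'rV[R]_n for idfun}).

Lemma ip_nondeg u v : (forall z, ip u z = ip v z) -> u = v.
Proof.
move=> E; apply/eqP; rewrite -subr_eq0; apply/negP => /negP ne0.
by have := neq0_dnorm_gt0 _ ne0 : 0 < ip _ _; rewrite linearBl /= E subrr ltxx.
Qed.

Lemma riesz : exists F : ('rV[R]_n -> R) -> 'rV[R]_n,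
  forall phi : 'rV[R]_n -> R, scalar phi -> forall z, ip (F phi) z = phi z.
Proof.
pose G : 'M[R]_n := \matrix_(i, j) ip (delta_mx 0 i) (delta_mx 0 j).
have GE v j : (v *m G) 0 j = ip v (delta_mx 0 j).
  rewrite {2}(row_sum_delta v) linear_sumlz mxE.
  by apply: eq_bigr => i _; rewrite !mxE linearZl_LR.
have GU : G \in unitmx.
  rewrite -row_free_unit -kermx_eq0; apply/rowV0P => v /sub_kermxP vG0.
  apply/ip_nondeg => z; rewrite linear0l (row_sum_delta z) linear_sumr big1 //.
  by move=> i _; rewrite linearZr_LR /= -GE vG0 mxE mulr0.
exists (fun phi => (\row_k phi (delta_mx 0 k)) *m invmx G) => phi phi_lin z.
pose f : {scalar 'rV[R]_n} :=
  HB.pack phi (GRing.isLinear.Build R _ _ _ phi phi_lin).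
rewrite -[phi]/(f : _ -> _) (row_sum_delta z) linear_sumr linear_sum.
apply: eq_bigr => i _; rewrite linearZr_LR linearZ /= -GE mulmxKV //.
by rewrite mxE.
Qed.

Variable br : 'rV[R]_n -> 'rV[R]_n -> 'rV[R]_n.
Hypothesis br_lie : lie_bracket br.

Let ipC u v : ip u v = ip v u.
Proof. by rewrite hermC /= expr0 mul1r. Qed.

Lemma koszul nabla : levi_civita br ip nabla -> forall x y z,
  2 * ip (nabla x y) z = ip (br x y) z - ip (br y z) x + ip (br z x) y.
Proof.
case=> _ tor met x y z; rewrite -!tor !linearBl /=.
have := (met x y z, met y z x, met z x y); case=> [[]].
rewrite !(ipC _ (nabla _ _)) => m1 m2 m3.
lra.
Qed.

Lemma levi_civita_exists : exists nabla, levi_civita br ip nabla.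
Proof.
have [F FE] := riesz; have [[lr ll] alt _] := br_lie.
have brC x y : br x y = - br y x.
  have D u v w : br (u + v) w = br u w + br v w.
    by have := ll w 1 u v; rewrite !scale1r.
  have E u v w : br w (u + v) = br w u + br w v.
    by have := lr w 1 u v; rewrite !scale1r.
  by apply/eqP; rewrite -addr_eq0; have := alt (x + y);
     rewrite D !E !alt add0r addr0 => ->.
pose k x y z := (ip (br x y) z - ip (br y z) x + ip (br z x) y) / 2.
have {}FE x y z : ip (F (k x y)) z = k x y z.
  apply: FE => a u v; rewrite /k lr ll !linearPl !linearPr /=; lra.
exists (fun x y => F (k x y)); split=> [|x y|x y z].
- split=> [x a u v|y a u v]; apply: ip_nondeg => z;
    by rewrite linearPl /= !FE /k lr ll !linearPl !linearPr /=; lra.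
- apply: ip_nondeg => z; rewrite linearBl /= !FE /k (brC y x) (brC x z) (brC z y).
  by rewrite !linearNl; lra.
- rewrite (ipC y) !FE /k (brC x z) (brC z y) (brC y x) !linearNl; lra.
Qed.

Lemma levi_civita_unique nabla1 nabla2 :
  levi_civita br ip nabla1 -> levi_civita br ip nabla2 ->
  forall x y, nabla1 x y = nabla2 x y.
Proof.
move=> /koszul k1 /koszul k2 x y; apply: ip_nondeg => z.
by apply: (@mulfI _ 2); rewrite ?pnatr_eq0 // k1 k2.
Qed.

End LeviCivita.

End Checks.

(* Main.v *)
(** In an orthonormal basis adapted to the centre, a nilsoliton metric turns the
    pencil spanned by J(Z_1), J(Z_2) into a congruent one spanned by skew
    matrices M_1, M_2, and Ric = c + D becomes: [\sum_k M_k ^ 2 = 2 (c + E)] with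
    E symmetric and [E M_k + M_k E = \sum_l d_lk M_l] with d symmetric.  A simple
    nonreal root of the pencil forces d to fix a nonreal direction, hence to be
    scalar; after a shift of E, it anticommutes with M_1 and M_2.  If the pencil
    is regular, E has trace zero and then [lam * \tr E + 2 * \tr (E ^ 2) = 0] gives E = 0; a
    block epsilon = 1 splits off orthogonally and reduces to this case.  So
    [\sum_k M_k ^ 2] is scalar, and comparing traces of diagonal blocks in a flag
    adapted to a Jordan block of size 2 shows that this block would split, which
    it does not.

    An isomorphism induces a real linear map of the plane of parameters (x, y)
    that permutes the complex points where the pencil drops rank: (1, 0), (1, 1)
    and (1, it), resp. (1, i) and (1, it), which determines t > 1. *)
From HB Require Import structures.
Require Import Defs.
From mathcomp Require Import all_boot all_order all_fingroup all_algebra.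
From mathcomp Require Import reals complex zify ring lra.
Set Implicit Arguments.
Unset Strict Implicit.
Unset Printing Implicit Defensive.
Import Order.TTheory GRing.Theory Num.Theory.
Local Open Scope ring_scope.

(** The obstacle is that the inner product is arbitrary: neither n1 and n2 nor the blocks of the
    pencil need be orthogonal. Orthonormal bases are therefore always taken triangular over the
    given one, so that final segments of the basis span the final coordinate subspaces. This puts
    the centre last, and it keeps the zero pattern of a pencil whose blocks are ordered with an
    isotropic subspace at the end; symmetry of E or skewness of M_k then makes triangular blocks
    diagonal.

    A nonreal root is what makes d scalar: it gives d the eigenvalues d_00 +- i tau d_01, whereas d
    is similar to a symmetric matrix and so has real ones. The simple root and the Jordan block sit
    at different roots: it and 0 in the first two families, i and it in the others. Hence r >= 1
    supplies the simple root i in the last four families; in the first two it supplies the second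
    real singular line, which fixes the scale of a parameter map.

    Isomorphisms enter only through an inequality of ranks, which sends singular points to singular
    points. *)

(** * Orthonormalisation by triangular matrices *)

Section GramSchmidt.
Variable R : rcfType.

Lemma quadE n (v : 'rV[R]_n) G : v *m G *m v^T = ((v *m G *m v^T) 0 0)%:M.
Proof. by rewrite [LHS]mx11_scalar. Qed.

(** Row [i] of [T] only involves coordinates of index at least [i], so the last rows form an
    orthonormal basis of the span of the last coordinates. The induction adds the first row last. *)
Lemma gram_schmidt n (G : 'M[R]_n) : G^T = G ->
  (forall v : 'rV_n, v != 0 -> 0 < (v *m G *m v^T) 0 0) ->
  exists2 T : 'M_n, forall i j : 'I_n, (j < i)%N -> T i j = 0 &
    T *m G *m T^T = 1%:M.
Proof.
elim: n G => [|n IH] G symG posG.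
  by exists 1%:M => [[]//|]; apply/matrixP => -[].
move: G symG posG; rewrite -[n.+1]/(1 + n)%N => G symG posG.
pose a := ulsubmx G; pose v := ursubmx G; pose H := drsubmx G.
have GE : G = block_mx a v v^T H.
  by rewrite -{1}[G]submxK /a /v /H trmx_ursub symG.
have symH : H^T = H by rewrite /H trmx_drsub symG.
have posH (w : 'rV_n) : w != 0 -> 0 < (w *m H *m w^T) 0 0.
  move=> w0; have := posG (row_mx 0 w).
  rewrite row_mx_eq0 eqxx w0 => /(_ isT).
  by rewrite GE mul_row_block tr_row_mx mul_row_col !mul0mx trmx0 mulmx0 !add0r.
have [T triT TH] := IH H symH posH.
have [T' T'E] : exists T' : 'M_n, T' *m T = 1%:M.
  by exists (H *m T^T); apply: mulmx1C; rewrite mulmxA.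
have invH : H *m (T^T *m T) = 1%:M.
  by rewrite mulmxA -(mul1mx (_ *m T)) -{1}T'E -!mulmxA [T *m _]mulmxA
             [T *m H *m _]mulmxA TH mul1mx.
(* Since [T^T *m T] is the inverse of [H], this [y] solves [v + y *m H = 0]: the new row is
   [G]-orthogonal to all later coordinates. *)
pose y := - v *m (T^T *m T).
have yH : v + y *m H = 0.
  rewrite /y mulNmx mulNmx -mulmxA.
  by rewrite (mulmx1C invH) mulmx1 subrr.
pose x : 'rV_(1 + n) := row_mx 1%:M y.
have xG : x *m G = row_mx (a + y *m v^T) 0.
  by rewrite GE mul_row_block !mul1mx yH.
have xpos : 0 < (x *m G *m x^T) 0 0.
  by apply: posG; rewrite row_mx_eq0 negb_and oner_eq0.
set q := (_ 0 0) in xpos.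
have xGx : x *m G *m x^T = q%:M by rewrite quadE.
pose tau := (Num.sqrt q)^-1.
exists (col_mx (tau *: x) (row_mx 0 T)).
  move=> i j; case: (split_ordP i) => k ->; first by rewrite ord1.
  rewrite col_mxEd; case: (split_ordP j) => l -> /= ji.
    by rewrite row_mxEl mxE.
  by rewrite row_mxEr triT.
rewrite mul_col_mx tr_col_mx mul_col_row -!scalemxAl linearZ /= -scalemxAr.
rewrite xGx xG tr_row_mx mul_row_col trmx0 mulmx0 mul0mx addr0 scaler0.
rewrite scalerA scale_scalar_mx -invfM -expr2 sqr_sqrtr ?ltW// mulVf ?gt_eqF//.
rewrite -[X in block_mx _ _ X _]mulmxA -[X in _ *m X]scalemxAr.
have -> : G *m x^T = (row_mx (a + y *m v^T) 0)^T.
  by rewrite -xG trmx_mul symG.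
rewrite tr_row_mx -scalemxAr mul_row_col mul0mx trmx0 mulmx0 addr0.
rewrite scaler0.
rewrite GE mul_row_block !mul0mx !add0r mul_row_col mulmx0 add0r TH.
by rewrite -scalar_mx_block.
Qed.

End GramSchmidt.

(** In a full rank factorisation A = C R, cancelling C on the left and R on the right of C R C R = 0
    leaves R C = 0, and tr A = tr (R C). *)
Lemma mxtrace_sqr0 (F : fieldType) n (A : 'M[F]_n) : A *m A = 0 -> \tr A = 0.
Proof.
rewrite -{1 2 3}(mulmx_base A) mxtrace_mulC => A2.
suff -> : row_base A *m col_base A = 0 by rewrite mxtrace0.
apply: (row_full_inj (col_base_full A)); rewrite mulmx0.
by apply: (row_free_inj (row_base_free A)); rewrite mul0mx -A2 !mulmxA.
Qed.

(** * Ricci tensor of a 2-step nilpotent metric Lie algebra *)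

Section Ricci.
Variables (R : realType) (n : nat) (ip : {dot 'rV[R]_n for idfun}).

Definition gram : 'M[R]_n := \matrix_(i, j) ip (delta_mx 0 i) (delta_mx 0 j).

Lemma gramE u v : ip u v = (u *m gram *m v^T) 0 0.
Proof.
rewrite {1}(row_sum_delta u) linear_sumlz /= mxE.
rewrite (eq_bigr (fun i => \sum_j u 0 i * (v 0 j * gram i j))); last first.
  move=> i _; rewrite linearZl_LR /= {1}(row_sum_delta v) linear_sumr /= mulr_sumr.
  by apply: eq_bigr => j _; rewrite linearZr_LR !mxE.
rewrite exchange_big; apply: eq_bigr => j _ /=; rewrite !mxE mulr_suml.
by apply: eq_bigr => i _; rewrite mulrA mulrAC.
Qed.

Lemma gram_rows p q (A : 'M_(p, n)) (B : 'M_(q, n)) i j :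
  (A *m gram *m B^T) i j = ip (row i A) (row j B).
Proof.
by rewrite gramE -row_mul !mxE; apply: eq_bigr => k _; rewrite !mxE.
Qed.

Lemma ipC u v : ip u v = ip v u.
Proof. by rewrite hermC /= expr0 mul1r. Qed.

Lemma gram_sym : gram^T = gram.
Proof. by apply/matrixP => i j; rewrite !mxE ipC. Qed.

Lemma orthonormal_rows : exists2 T : 'M[R]_n,
  forall i j : 'I_n, (j < i)%N -> T i j = 0 & T *m gram *m T^T = 1%:M.
Proof.
apply: gram_schmidt gram_sym _ => v v0; rewrite -gramE.
exact: neq0_dnorm_gt0.
Qed.

Variable T : 'M[R]_n.
Hypothesis TG : T *m gram *m T^T = 1%:M.

Lemma ip_row i j : ip (row i T) (row j T) = (i == j)%:R.
Proof. by rewrite -gram_rows TG mxE. Qed.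

Lemma gram_inv : gram *m T^T *m T = 1%:M.
Proof. by apply: mulmx1C; rewrite mulmxA. Qed.

Lemma parseval x y : ip x y = \sum_i ip x (row i T) * ip (row i T) y.
Proof.
have -> : ip x y = (x *m gram *m T^T *m (T *m gram *m y^T)) 0 0.
  by rewrite gramE -{1}[gram]mul1mx -gram_inv !mulmxA.
rewrite mxE; apply: eq_bigr => i _.
by rewrite !gram_rows !row_id.
Qed.

Lemma mxtrace_lin1 (f : 'rV[R]_n -> 'rV[R]_n) : linear f ->
  \tr (lin1_mx f) = \sum_i ip (f (row i T)) (row i T).
Proof.
move=> f_lin; pose g : {linear 'rV[R]_n -> 'rV[R]_n} :=
  HB.pack f (GRing.isLinear.Build R _ _ _ f f_lin).
rewrite -[f]/(g : _ -> _) -[lin1_mx _]mulmx1 -gram_inv.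
rewrite !mulmxA mxtrace_mulC !mulmxA; apply: eq_bigr => i _.
by rewrite gram_rows row_mul mul_rV_lin1.
Qed.

Variables br nabla : 'rV[R]_n -> 'rV[R]_n -> 'rV[R]_n.
Hypothesis br_lie : lie_bracket br.
Hypothesis br_2step : forall x y z, br x (br y z) = 0.
Hypothesis lc : levi_civita br ip nabla.

Lemma sum_sym_skew (f g : 'I_n -> 'I_n -> R) :
  (forall i j, f j i = f i j) -> (forall i j, g j i = - g i j) ->
  \sum_i \sum_j f i j * g i j = 0.
Proof.
move=> fs gs; set s := LHS; have : s = - s; last by lra.
rewrite {1}/s exchange_big /= -sumrN; apply: eq_bigr => i _; rewrite -sumrN.
by apply: eq_bigr => j _; rewrite fs gs mulrN.
Qed.

Lemma br_skew x y : br x y = - br y x.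
Proof.
have [[lr ll] alt _] := br_lie.
have D u v w : br (u + v) w = br u w + br v w.
  by have := ll w 1 u v; rewrite !scale1r.
have E u v w : br w (u + v) = br w u + br w v.
  by have := lr w 1 u v; rewrite !scale1r.
by apply/eqP; rewrite -addr_eq0; have := alt (x + y);
   rewrite D !E !alt add0r addr0 => ->.
Qed.

Lemma br_x0 x : br x 0 = 0.
Proof.
by have [[lr _] _ _] := br_lie; have := lr x (-1) 0 0; rewrite scaler0 scaleN1r addr0 addNr.
Qed.

Lemma br_Zr x c y : br x (c *: y) = c *: br x y.
Proof. by have [[lr _] _ _] := br_lie; have := lr x c y 0; rewrite br_x0 !addr0. Qed.

Lemma ip_ad_trace w : \sum_i ip (br w (row i T)) (row i T) = 0.
Proof.
have [[lr _] _ _] := br_lie.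
rewrite -mxtrace_lin1; last exact: lr.
pose g : {linear 'rV[R]_n -> 'rV[R]_n} :=
  HB.pack (br w) (GRing.isLinear.Build R _ _ _ (br w) (lr w)).
rewrite -[br w]/(g : _ -> _); apply: mxtrace_sqr0.
by apply/row_matrixP => i; rewrite row0 !rowE mulmxA !mul_rV_lin1 /= br_2step.
Qed.

Lemma ricci_2step y z : ricci_tensor br nabla y z =
  - (\sum_i ip (br (row i T) y) (br (row i T) z)) / 2 +
  (\sum_i \sum_j ip (br (row i T) (row j T)) y * ip (br (row i T) (row j T)) z) / 4.
Proof.
have kos := koszul lc.
have [[nr nl] _ met] := lc; have [[lr ll] alt _] := br_lie.
have br0 x u v : br (br x u) v = 0 by rewrite br_skew br_2step oppr0.
rewrite /ricci_tensor mxtrace_lin1; last first.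
  move=> a u v; rewrite /curvature ll !nl.
  have -> : nabla y (a *: nabla u z + nabla v z) =
      a *: nabla y (nabla u z) + nabla y (nabla v z) by rewrite nr.
  by rewrite !scalerBr; apply/rowP => k; rewrite !mxE; ring.
pose t i := row i T.
(* Koszul turns the first curvature term into minus the trace of the adjoint of [nabla y z], which
   is zero because its square is zero; the bracket term contributes the half-sum of the
   statement. *)
rewrite -/t (eq_bigr (fun i => ip (br (nabla y z) (t i)) (t i) * - 1 +
   ip (nabla (t i) z) (nabla y (t i)) - ip (br (t i) y) (br (t i) z) / 2)); last first.
  move=> i _; rewrite /curvature !linearBl /=.
  have k1 := kos (t i) (nabla y z) (t i).
  have k2 := kos (br (t i) y) z (t i).
  have m := met y (nabla (t i) z) (t i).
  move: k1 k2; rewrite !br0 br_2step !linear0l alt linear0l.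
  rewrite (br_skew (t i) (nabla y z)) (br_skew z) !linearNl /=.
  rewrite (ipC (br (t i) z)) => k1 k2.
  move: m k1 k2; rewrite -/t; lra.
rewrite !big_split /= -mulr_suml ip_ad_trace mul0r add0r addrC.
congr (_ + _); first by rewrite sumrN -mulr_suml mulNr.
(* By Koszul, what remains is -1/4 of the sum of (a + a^T + s)(p - p^T - q) over all entries. The
   symmetric a + a^T cancels against the skew p - p^T - q, the sum of s p collapses to terms <[t_i,
   [y, t_i]], z> = 0, and only s q survives. *)
pose a i j := ip (br z (t i)) (t j); pose p i j := ip (br y (t i)) (t j).
pose s i j := ip (br (t i) (t j)) z; pose q i j := ip (br (t i) (t j)) y.
have anti f i j : ip (br (t j) (t i)) f = - ip (br (t i) (t j)) f.
  by rewrite br_skew linearNl.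
have sp0 : \sum_i \sum_j s i j * p i j = 0.
  rewrite big1 // => i _; rewrite -[RHS](linear0l ip z) -(br_2step (t i) y (t i)).
  rewrite /s /p.
  have E u : ip (br (t i) u) z = \sum_j ip (br (t i) (t j)) z * ip u (t j).
    pose g : {linear 'rV[R]_n -> 'rV[R]_n} :=
      HB.pack (br (t i)) (GRing.isLinear.Build R _ _ _ (br (t i)) (lr (t i))).
    have uE : u = \sum_j ip u (t j) *: t j.
      apply: (ip_nondeg (ip := ip)) => v; rewrite parseval linear_sumlz /=.
      by apply: eq_bigr => j _; rewrite linearZl_LR.
    rewrite [in LHS]uE -[br _]/(g : _ -> _) linear_sum linear_sumlz /=.
    by apply: eq_bigr => j _; rewrite br_Zr linearZl_LR mulrC.
  exact/esym/E.
have as0 : \sum_i \sum_j (a i j + a j i) * (p i j - p j i - q i j) = 0.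
  apply: sum_sym_skew => i j; first by rewrite addrC.
  by rewrite /q anti; ring.
have sp0' : \sum_i \sum_j s i j * p j i = 0.
  transitivity (- \sum_i \sum_j s i j * p i j); last by rewrite sp0 oppr0.
  rewrite exchange_big /= -sumrN; apply: eq_bigr => i _.
  by rewrite -sumrN; apply: eq_bigr => j _; rewrite /s anti mulNr.
transitivity ((\sum_i \sum_j s i j * q i j - \sum_i \sum_j s i j * p i j
   + \sum_i \sum_j s i j * p j i
   - \sum_i \sum_j (a i j + a j i) * (p i j - p j i - q i j)) / 4); last first.
  rewrite sp0 sp0' as0 subr0 addr0 subr0; congr (_ / _).
  by apply: eq_bigr => i _; apply: eq_bigr => j _; rewrite mulrC.
rewrite -!sumrB -!big_split -sumrB mulr_suml; apply: eq_bigr => i _ /=.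
rewrite -!sumrB -!big_split -sumrB mulr_suml parseval; apply: eq_bigr => j _ /=.
have := kos (t i) z (t j); have := kos y (t i) (t j).
rewrite -/(t j) (ipC (t j) (nabla _ _)) (br_skew (t i) z) (br_skew (t j) y).
rewrite (anti z i j) !linearNl /= -/(a i j) -/(a j i) -/(p i j) -/(p j i).
rewrite -/(s i j) -/(q i j) => k1 k2.
have -> : ip (nabla (t i) z) (t j) = (- a i j - a j i - s i j) / 2 by lra.
have -> : ip (nabla y (t i)) (t j) = (p i j - q i j - p j i) / 2 by lra.
by field.
Qed.

End Ricci.

(** * The nilsoliton condition as matrix equations for a pencil *)

Section PencilBracket.
Variables (R : realType) (N p : nat) (J : 'I_p -> 'M[R]_N).
Hypothesis J_skew : forall k, (J k)^T = - J k.

Definition mxform (A : 'M[R]_N) (u v : 'rV[R]_N) : R := (u *m A *m v^T) 0 0.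

Lemma mxformPl A a u v w : mxform A (a *: u + v) w = a * mxform A u w + mxform A v w.
Proof. by rewrite /mxform mulmxDl mulmxDl -!scalemxAl !mxE. Qed.

Lemma mxformPr A a u v w : mxform A w (a *: u + v) = a * mxform A w u + mxform A w v.
Proof. by rewrite /mxform linearP /= mulmxDr -!scalemxAr !mxE. Qed.

Lemma mxform_skew A u v : A^T = - A -> mxform A u v = - mxform A v u.
Proof.
move=> sA; rewrite /mxform.
transitivity ((u *m A *m v^T)^T 0 0); first by rewrite [RHS]mxE.
by rewrite !trmx_mul trmxK sA mulNmx mulmxN mxE mulmxA.
Qed.

Definition mu_of (X Y : 'rV[R]_N) : 'rV[R]_p := \row_k (Y *m J k *m X^T) 0 0.

Lemma mu_ofE X Y k : mu_of X Y 0 k = mxform (J k) Y X.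
Proof. by rewrite mxE. Qed.

Lemma mu_of_bilinear : bilinear_map mu_of.
Proof.
split=> [x a u v|y a u v]; apply/rowP => k;
  rewrite [RHS]mxE [X in _ = X + _]mxE !mu_ofE; [exact: mxformPl|exact: mxformPr].
Qed.

Lemma mu_of_skew X Y : mu_of X Y = - mu_of Y X.
Proof. by apply/rowP => k; rewrite [RHS]mxE !mu_ofE mxform_skew. Qed.

Lemma bracket_of_lie : lie_bracket (bracket_of mu_of).
Proof.
have [mr ml] := mu_of_bilinear.
have mu0 x : mu_of x 0 = 0.
  by have := mr x (-1) 0 0; rewrite scaler0 scaleN1r addr0 addNr.
split=> [|x|x y z].
- split=> [x a u v|y a u v]; rewrite /bracket_of linearP ?mr ?ml /=;
    by rewrite scale_row_mx add_row_mx scaler0 addr0.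
- rewrite /bracket_of -[RHS]row_mx0; congr row_mx.
  move: (mu_of _ _) (mu_of_skew (lsubmx x) (lsubmx x)) => w /rowP wN.
  by apply/rowP => k; move: (wN k); rewrite !mxE; lra.
- by rewrite /bracket_of !row_mxKl !mu0 row_mx0 !addr0.
Qed.

Lemma bracket_of_2step x y z : bracket_of mu_of x (bracket_of mu_of y z) = 0.
Proof.
have [mr _] := mu_of_bilinear.
rewrite /bracket_of row_mxKl.
by have := mr (lsubmx x) (-1) 0 0; rewrite scaler0 scaleN1r addr0 addNr => ->; rewrite row_mx0.
Qed.

Definition congr_comb (T : 'M[R]_N) (h : 'M[R]_p) (k : 'I_p) : 'M[R]_N :=
  \sum_l h l k *: (T *m J l *m T^T).

Lemma congr_comb_skew T h k : (congr_comb T h k)^T = - congr_comb T h k.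
Proof.
rewrite /congr_comb linear_sum -sumrN; apply: eq_bigr => l _.
by rewrite linearZ /= !trmx_mul trmxK J_skew mulNmx mulmxN scalerN mulmxA.
Qed.

(** [E] and [d] are the diagonal blocks of the derivation in the triangular orthonormal basis; they
    are symmetric because the Ricci tensor is. Basis vectors outside the centre enter brackets only
    through their n1-components [T], so n1 and n2 may fail to be orthogonal. The first equation is
    the Ricci formula off the centre, the second is the derivation rule paired with central basis
    vectors. *)
Lemma nilsoliton_congr_comb : (exists ip, nilsoliton (bracket_of mu_of) ip) ->
  exists (T : 'M[R]_N) (h : 'M[R]_p) (c : R) (E : 'M[R]_N) (d : 'M[R]_p),
  [/\ T \in unitmx, h \in unitmx, E^T = E, d^T = d &
    \sum_k congr_comb T h k *m congr_comb T h k = 2 *: (c%:M + E) /\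
    forall k, E *m congr_comb T h k + congr_comb T h k *m E =
              \sum_l d l k *: congr_comb T h l].
Proof.
case=> ip [Ric [[nabla lc RicE]]] [c [D [Dder DE]]].
have [U triU UG] := orthonormal_rows ip.
set br := bracket_of mu_of in lc RicE Dder.
have lie : lie_bracket br := bracket_of_lie.
have bb : forall x y z, br x (br y z) = 0 := bracket_of_2step.
have ric := ricci_2step UG lie bb lc.
have par := parseval UG.
pose T := ulsubmx U; pose g := drsubmx U.
have UE : U = block_mx T (ursubmx U) 0 g.
  rewrite -[LHS]submxK; congr block_mx; apply/matrixP => i j.
  by rewrite !mxE triU //= ltn_addr.
have Uu : U \in unitmx.
  by have [/[!unitmx_mul]/andP[]] := mulmx1_unit UG.
move: (Uu); rewrite UE unitmxE det_ublock unitrM -!unitmxE => /andP[Tu gu].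
(* The rows of [g] are the orthonormal central vectors, so [h] converts the value of [mu_of] into
   its orthonormal coordinates. *)
pose h := invmx g; pose M := congr_comb T h.
pose t i := row i U.
have tl i : lsubmx (t (lshift p i)) = row i T.
  by apply/rowP => j; rewrite !mxE.
have tr k : t (rshift N k) = row_mx 0 (row k g).
  apply/rowP => j; rewrite /t UE !mxE; case: (split_ordP (rshift N k)) => i.
    by move/eqP; rewrite eq_rlshift.
  by move/rshift_inj <-; rewrite !mxE; case: splitP => l _; rewrite !mxE.
have tr0 k : lsubmx (t (rshift N k)) = 0 by rewrite tr row_mxKl.
have brE x y : br x y = \sum_q (mu_of (lsubmx x) (lsubmx y) *m h) 0 q *: t (rshift N q).
  rewrite -[LHS]/(row_mx 0 _); set w := mu_of _ _.
  have -> : row_mx 0 w = row_mx (0 : 'rV_N) (w *m h) *m U.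
    by rewrite UE mul_row_block !mul0mx add0r mulmx0 add0r mulmxKV.
  rewrite mulmx_sum_row big_split_ord /= [X in X + _]big1 ?add0r => [|q _]; last first.
    by rewrite row_mxEl mxE scale0r.
  by apply: eq_bigr => q _; rewrite row_mxEr.
have brl x y k : ip (br x y) (t (rshift N k)) =
    \sum_l h l k * mxform (J l) (lsubmx y) (lsubmx x).
  rewrite brE.
  rewrite linear_sumlz (bigD1 k) //= big1 ?addr0 => [|q /negPf qk].
    rewrite linearZl_LR /= ip_row // eqxx mulr1 mxE.
    by apply: eq_bigr => l _; rewrite mulrC mu_ofE.
  by rewrite linearZl_LR /= ip_row // eq_rshift qk mulr0.
have brM i j k : ip (br (t (lshift p i)) (t (lshift p j))) (t (rshift N k)) = M k j i.
  rewrite brl /M /congr_comb summxE; apply: eq_bigr => l _; rewrite !tl mxE.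
  congr (_ * _); rewrite /mxform tr_row -row_mul.
  by rewrite !mxE; apply: eq_bigr => q _; rewrite !mxE.
have br0 x y i : ip (br x y) (t (lshift p i)) = 0.
  rewrite brE.
  rewrite linear_sumlz /= big1 // => q _.
  by rewrite linearZl_LR /= ip_row // eq_rlshift mulr0.
have brc x k : br (t (rshift N k)) x = 0.
  rewrite /br /bracket_of tr0 -[RHS]row_mx0; congr row_mx; apply/rowP => l.
  by rewrite mu_ofE /mxform trmx0 mulmx0 !mxE.
have ric_sym y z : ricci_tensor br nabla y z = ricci_tensor br nabla z y.
  rewrite !ric; congr (- _ / _ + _ / _); apply: eq_bigr => i _; first exact: ipC.
  by apply: eq_bigr => j _; rewrite mulrC.
have D_sym y z : ip (D y) z = ip y (D z).
  have Dy u : D u = Ric u - c *: u by rewrite DE addrC addKr.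
  rewrite (ipC ip y) !Dy !linearBl /= !linearZl_LR /= !RicE ric_sym.
  by rewrite (ipC ip y).
pose E := \matrix_(i, j) ip (D (t (lshift p i))) (t (lshift p j)) : 'M[R]_N.
pose d := \matrix_(l, k) ip (D (t (rshift N l))) (t (rshift N k)) : 'M[R]_p.
have MT k i j : M k i j = - M k j i.
  by have := congr1 (fun A : 'M_N => A j i) (congr_comb_skew T h k); rewrite 2!mxE.
exists T, h, c, E, d; split=> //.
- by rewrite unitmx_inv.
- by apply/matrixP => i j; rewrite !mxE D_sym ipC.
- by apply/matrixP => i j; rewrite !mxE D_sym ipC.
split.
  apply/matrixP => i j; rewrite summxE -/M !mxE.
  have -> : ip (D (t (lshift p i))) (t (lshift p j)) =
      ricci_tensor br nabla (t (lshift p i)) (t (lshift p j)) - c * (i == j)%:R.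
    rewrite -RicE DE linearDl /= linearZl_LR /= ip_row // eq_lshift; ring.
  rewrite ric [X in _ + X / 4]big1 => [|q _]; last first.
    by rewrite big1 // => q' _; rewrite br0 mul0r.
  rewrite big_split_ord /= [X in - (_ + X)]big1 ?addr0 => [|q _]; last first.
    by rewrite -/t brc linear0l.
  rewrite mul0r addr0 -/t.
  have -> : \sum_(q < N) ip (br (t (lshift p q)) (t (lshift p i)))
              (br (t (lshift p q)) (t (lshift p j))) =
            - \sum_k (M k *m M k) i j.
    rewrite (eq_bigr (fun q => \sum_k M k i q * M k j q)) => [|q _]; last first.
      rewrite par big_split_ord /= [X in X + _]big1 ?add0r => [|l _]; last first.
        by rewrite br0 mul0r.
      by apply: eq_bigr => l _; rewrite -/t brM ipC brM.
    rewrite exchange_big -sumrN; apply: eq_bigr => k _ /=.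
    by rewrite mxE -sumrN; apply: eq_bigr => q _; rewrite (MT k q j) mulrN opprK.
  by rewrite -mulr_natr; field.
have brx x j k : ip (br x (t (lshift p j))) (t (rshift N k)) =
    \sum_q ip x (t (lshift p q)) * M k j q.
  pose f y := ip (br y (t (lshift p j))) (t (rshift N k)).
  have [[_ ll] _ _] := lie.
  have f_lin : scalar f by move=> a u v; rewrite /f ll linearPl.
  pose F : {scalar 'rV[R]_(N + p)} := HB.pack f (GRing.isLinear.Build R _ _ _ f f_lin).
  have fZ a u : f (a *: u) = a * f u by exact: (linearZ_LR F).
  rewrite -[LHS]/(F x).
  have xE : x = \sum_q ip x (t q) *: t q.
    apply: (ip_nondeg (ip := ip)) => v; rewrite par linear_sumlz /=.
    by apply: eq_bigr => q _; rewrite linearZl_LR.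
  rewrite {1}xE linear_sum big_split_ord /= [X in _ + X]big1 ?addr0 => [|q _].
    by apply: eq_bigr => q _; rewrite fZ -brM.
  by rewrite fZ /f brc linear0l mulr0.
move=> k; apply/matrixP => i j.
have := congr1 (fun u => ip u (t (rshift N k))) (Dder (t (lshift p i)) (t (lshift p j))).
rewrite /= linearDl /= (br_skew lie _ (D _)) linearNl /= !brx D_sym par big_split_ord /=.
rewrite [X in X + _]big1 ?add0r => [|q _]; last by rewrite br0 mul0r.
move=> eqn; rewrite summxE -/M [LHS]mxE [X in X + _]mxE [X in _ + X]mxE.
transitivity (- (\sum_q ip (D (t (lshift p i))) (t (lshift p q)) * M k j q -
    \sum_q ip (D (t (lshift p j))) (t (lshift p q)) * M k i q)).
  rewrite opprB addrC -sumrN; congr (_ + _); apply: eq_bigr => q _.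
    by rewrite [E _ _]mxE mulrC D_sym ipC.
  by rewrite [E _ _]mxE (MT k q j) mulrN.
rewrite -eqn -sumrN; apply: eq_bigr => q _.
by rewrite brM -/t [d _ _]mxE [in RHS]mxE (MT q i j) D_sym mulrN mulrC.
Qed.
End PencilBracket.

(** * Calculus of 3 x 3 block matrices, and positivity of tr (A A^T) *)

Section Blocks3.
Variable R : comNzRingType.

Definition mx3 n1 n2 n3 m1 m2 m3 (a : 'M[R]_(n1, m1)) (b : 'M_(n1, m2)) (c : 'M_(n1, m3))
    (d : 'M_(n2, m1)) (e : 'M_(n2, m2)) (f : 'M_(n2, m3))
    (g : 'M_(n3, m1)) (h : 'M_(n3, m2)) (i : 'M_(n3, m3)) :
    'M_(n1 + (n2 + n3), m1 + (m2 + m3)) :=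
  block_mx a (row_mx b c) (col_mx d g) (block_mx e f h i).

Lemma mx3_eta n1 n2 n3 m1 m2 m3 (A : 'M[R]_(n1 + (n2 + n3), m1 + (m2 + m3))) :
  exists a b c d e f g h i, A = mx3 a b c d e f g h i.
Proof.
exists (ulsubmx A), (lsubmx (ursubmx A)), (rsubmx (ursubmx A)), (usubmx (dlsubmx A)).
exists (ulsubmx (drsubmx A)), (ursubmx (drsubmx A)), (dsubmx (dlsubmx A)).
exists (dlsubmx (drsubmx A)), (drsubmx (drsubmx A)).
by rewrite /mx3 hsubmxK vsubmxK submxK submxK.
Qed.

Lemma mx3_inj n1 n2 n3 m1 m2 m3 (a : 'M[R]_(n1, m1)) (b : 'M_(n1, m2)) (c : 'M_(n1, m3))
    (d : 'M_(n2, m1)) (e : 'M_(n2, m2)) (f : 'M_(n2, m3))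
    (g : 'M_(n3, m1)) (h : 'M_(n3, m2)) (i : 'M_(n3, m3)) a' b' c' d' e' f' g' h' i' :
  mx3 a b c d e f g h i = mx3 a' b' c' d' e' f' g' h' i' ->
  [/\ [/\ a = a', b = b' & c = c'], [/\ d = d', e = e' & f = f'] &
      [/\ g = g', h = h' & i = i']].
Proof.
by case/eq_block_mx => -> /eq_row_mx[-> ->] /eq_col_mx[-> ->] /eq_block_mx[-> -> -> ->].
Qed.

Lemma tr_mx3 n1 n2 n3 m1 m2 m3 (a : 'M[R]_(n1, m1)) (b : 'M_(n1, m2)) (c : 'M_(n1, m3))
    (d : 'M_(n2, m1)) (e : 'M_(n2, m2)) (f : 'M_(n2, m3))
    (g : 'M_(n3, m1)) (h : 'M_(n3, m2)) (i : 'M_(n3, m3)) :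
  (mx3 a b c d e f g h i)^T = mx3 a^T d^T g^T b^T e^T h^T c^T f^T i^T.
Proof. by rewrite /mx3 !tr_block_mx tr_col_mx tr_row_mx. Qed.

Lemma mul_mx3 n1 n2 n3 m1 m2 m3 p1 p2 p3
    (a : 'M[R]_(n1, m1)) (b : 'M_(n1, m2)) (c : 'M_(n1, m3))
    (d : 'M_(n2, m1)) (e : 'M_(n2, m2)) (f : 'M_(n2, m3))
    (g : 'M_(n3, m1)) (h : 'M_(n3, m2)) (i : 'M_(n3, m3))
    (a' : 'M[R]_(m1, p1)) (b' : 'M_(m1, p2)) (c' : 'M_(m1, p3))
    (d' : 'M_(m2, p1)) (e' : 'M_(m2, p2)) (f' : 'M_(m2, p3))
    (g' : 'M_(m3, p1)) (h' : 'M_(m3, p2)) (i' : 'M_(m3, p3)) :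
  mx3 a b c d e f g h i *m mx3 a' b' c' d' e' f' g' h' i' =
  mx3 (a *m a' + b *m d' + c *m g') (a *m b' + b *m e' + c *m h') (a *m c' + b *m f' + c *m i')
      (d *m a' + e *m d' + f *m g') (d *m b' + e *m e' + f *m h') (d *m c' + e *m f' + f *m i')
      (g *m a' + h *m d' + i *m g') (g *m b' + h *m e' + i *m h') (g *m c' + h *m f' + i *m i').
Proof.
rewrite /mx3 mulmx_block mul_row_col mul_mx_row mul_row_block add_row_mx.
rewrite mul_col_mx mul_block_col add_col_mx mul_col_row mulmx_block add_block_mx.
by rewrite !addrA.
Qed.

Lemma add_mx3 n1 n2 n3 m1 m2 m3 (a : 'M[R]_(n1, m1)) (b : 'M_(n1, m2)) (c : 'M_(n1, m3))
    (d : 'M_(n2, m1)) (e : 'M_(n2, m2)) (f : 'M_(n2, m3))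
    (g : 'M_(n3, m1)) (h : 'M_(n3, m2)) (i : 'M_(n3, m3)) a' b' c' d' e' f' g' h' i' :
  mx3 a b c d e f g h i + mx3 a' b' c' d' e' f' g' h' i' =
  mx3 (a + a') (b + b') (c + c') (d + d') (e + e') (f + f') (g + g') (h + h') (i + i').
Proof. by rewrite /mx3 !add_block_mx add_row_mx add_col_mx. Qed.

Lemma scale_mx3 n1 n2 n3 m1 m2 m3 x (a : 'M[R]_(n1, m1)) (b : 'M_(n1, m2)) (c : 'M_(n1, m3))
    (d : 'M_(n2, m1)) (e : 'M_(n2, m2)) (f : 'M_(n2, m3))
    (g : 'M_(n3, m1)) (h : 'M_(n3, m2)) (i : 'M_(n3, m3)) :
  x *: mx3 a b c d e f g h i = mx3 (x *: a) (x *: b) (x *: c) (x *: d) (x *: e) (x *: f)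
     (x *: g) (x *: h) (x *: i).
Proof. by rewrite /mx3 !scale_block_mx scale_row_mx scale_col_mx. Qed.

Lemma opp_mx3 n1 n2 n3 m1 m2 m3 (a : 'M[R]_(n1, m1)) (b : 'M_(n1, m2)) (c : 'M_(n1, m3))
    (d : 'M_(n2, m1)) (e : 'M_(n2, m2)) (f : 'M_(n2, m3))
    (g : 'M_(n3, m1)) (h : 'M_(n3, m2)) (i : 'M_(n3, m3)) :
  - mx3 a b c d e f g h i = mx3 (- a) (- b) (- c) (- d) (- e) (- f) (- g) (- h) (- i).
Proof. by rewrite -scaleN1r scale_mx3 !scaleN1r. Qed.

Lemma mx3_scalar n1 n2 n3 x :
  x%:M = mx3 (x%:M : 'M[R]_n1) 0 0 0 (x%:M : 'M_n2) 0 0 0 (x%:M : 'M_n3).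
Proof. by rewrite /mx3 row_mx0 col_mx0 -!scalar_mx_block. Qed.

Lemma mx3_0 n1 n2 n3 m1 m2 m3 : 0 =
  mx3 (0 : 'M[R]_(n1, m1)) (0 : 'M_(n1, m2)) (0 : 'M_(n1, m3)) (0 : 'M_(n2, m1)) 0 0
      (0 : 'M_(n3, m1)) 0 0.
Proof. by rewrite /mx3 row_mx0 col_mx0 !block_mx0. Qed.

Lemma tr_mx3_trace n1 n2 n3 (a : 'M[R]_n1) (b : 'M_(n1, n2)) (c : 'M_(n1, n3))
    (d : 'M_(n2, n1)) (e : 'M_n2) (f : 'M_(n2, n3))
    (g : 'M_(n3, n1)) (h : 'M_(n3, n2)) (i : 'M_n3) :
  \tr (mx3 a b c d e f g h i) = \tr a + \tr e + \tr i.
Proof. by rewrite /mx3 !mxtrace_block addrA. Qed.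

End Blocks3.

Section Trace.
Variable R : realDomainType.

Lemma mxtrace_mul_tr n m (A : 'M[R]_(n, m)) : \tr (A *m A^T) = \sum_i \sum_j A i j ^+ 2.
Proof.
by apply: eq_bigr => i _; rewrite mxE; apply: eq_bigr => j _; rewrite mxE expr2.
Qed.

Lemma mxtrace_mul_tr_ge0 n m (A : 'M[R]_(n, m)) : 0 <= \tr (A *m A^T).
Proof.
by rewrite mxtrace_mul_tr; apply: sumr_ge0 => i _; apply: sumr_ge0 => j _; apply: sqr_ge0.
Qed.

Lemma mxtrace_mul_tr_eq0 n m (A : 'M[R]_(n, m)) : \tr (A *m A^T) = 0 -> A = 0.
Proof.
rewrite mxtrace_mul_tr => /eqP; rewrite psumr_eq0 => [/allP A0|i _]; last first.
  by apply: sumr_ge0 => j _; apply: sqr_ge0.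
apply/matrixP => i j; have /eqP := A0 i (mem_index_enum i).
move/eqP; rewrite psumr_eq0 => [/allP Ai|k _]; last exact: sqr_ge0.
by have := Ai j (mem_index_enum j); rewrite /= sqrf_eq0 mxE => /eqP.
Qed.

Lemma sum_mxtrace_mul_tr_eq0 (I : finType) n m (A : I -> 'M[R]_(n, m)) :
  \sum_i \tr (A i *m (A i)^T) = 0 -> forall i, A i = 0.
Proof.
move=> /eqP; rewrite psumr_eq0 => [/allP A0 i|i _]; last exact: mxtrace_mul_tr_ge0.
by apply: mxtrace_mul_tr_eq0; apply/eqP; apply: (A0 i (mem_index_enum i)).
Qed.

End Trace.

(** * The soliton equations and their invariance *)

Section SolitonEquations.
Variable R : realType.

(* [congr_comb J T h k] are the matrices of [J] in an orthonormal basis.  The  *)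
(* derivation is [E] up to a multiple of the derivation (1, 2) of n1 + n2.     *)
Record soliton_eqs N p (J : 'I_p -> 'M[R]_N) (T : 'M[R]_N) (h : 'M[R]_p)
    (lam : R) (E : 'M[R]_N) : Prop := SolitonEqs {
  soliton_unitT : T \in unitmx;
  soliton_unith : h \in unitmx;
  soliton_sym : E^T = E;
  soliton_sqr : \sum_k congr_comb J T h k *m congr_comb J T h k = lam%:M + 2 *: E;
  soliton_anti : forall k, E *m congr_comb J T h k + congr_comb J T h k *m E = 0 }.

(** Carries linear identities from the orthonormal parameters of the centre back to the original
    ones. *)
Lemma comb_eq0 (V : lmodType R) p (h : 'M[R]_p) (X : 'I_p -> V) : h \in unitmx ->
  (forall k, \sum_l h l k *: X l = 0) -> forall l, X l = 0.
Proof.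
move=> hu X0 l.
have : \sum_k invmx h k l *: \sum_q h q k *: X q = 0.
  by rewrite big1 // => k _; rewrite X0 scaler0.
under eq_bigr => k _ do rewrite scaler_sumr.
rewrite exchange_big (bigD1 l) //= [X in _ + X]big1 ?addr0 => [|q ql].
  under eq_bigr => k _ do rewrite scalerA mulrC.
  rewrite -scaler_suml; have := congr1 (fun A : 'M_p => A l l) (mulmxV hu).
  by rewrite !mxE eqxx => ->; rewrite scale1r.
under eq_bigr => k _ do rewrite scalerA mulrC.
rewrite -scaler_suml; have := congr1 (fun A : 'M_p => A q l) (mulmxV hu).
by rewrite !mxE (negPf ql) => ->; rewrite scale0r.
Qed.

Lemma congr_comb_mul N p (J : 'I_p -> 'M[R]_N) (T P : 'M[R]_N) h k :
  congr_comb J (P *m T) h k = P *m congr_comb J T h k *m P^T.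
Proof.
rewrite /congr_comb mulmx_sumr mulmx_suml; apply: eq_bigr => l _.
by rewrite -scalemxAr -scalemxAl trmx_mul !mulmxA.
Qed.

Lemma soliton_rotate N p (J : 'I_p -> 'M[R]_N) T h lam E O : O *m O^T = 1%:M ->
  soliton_eqs J T h lam E -> soliton_eqs J (O *m T) h lam (O *m E *m O^T).
Proof.
move=> OO [Tu hu sE sqrE antiE]; have OO' := mulmx1C OO.
split=> //; first by rewrite unitmx_mul Tu andbT; case/mulmx1_unit: OO.
- by rewrite !trmx_mul trmxK sE mulmxA.
- rewrite (eq_bigr (fun k => O *m (congr_comb J T h k *m congr_comb J T h k) *m O^T)).
    rewrite -mulmx_suml -mulmx_sumr sqrE mulmxDr mulmxDl -scalemxAr -scalemxAl.
    by rewrite scalar_mxC -[_ *m O *m O^T]mulmxA OO mulmx1.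
  move=> k _; rewrite congr_comb_mul -!mulmxA; congr (_ *m (_ *m _)).
  by rewrite !mulmxA OO' mul1mx.
move=> k; rewrite congr_comb_mul; set M := congr_comb J T h k.
have KO A : A *m O^T *m O = A by rewrite -mulmxA OO' mulmx1.
transitivity (O *m (E *m M + M *m E) *m O^T); last by rewrite antiE mulmx0 mul0mx.
by rewrite mulmxDr mulmxDl !mulmxA !KO.
Qed.

(** The inner product for which the rows of [T] are orthonormal has Gram matrix
    [invmx T *m (invmx T)^T]. A triangular orthonormal basis for it differs from [T] by an
    orthogonal matrix, and the equations are invariant under rotation. *)
Lemma soliton_upper N p (J : 'I_p -> 'M[R]_N) T h lam E : soliton_eqs J T h lam E ->
  exists T' O : 'M[R]_N, [/\ forall i j : 'I_N, (j < i)%N -> T' i j = 0, O *m O^T = 1%:M &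
    soliton_eqs J T' h lam (O *m E *m O^T)].
Proof.
move=> sol; have Tu := soliton_unitT sol.
have [] := @gram_schmidt _ _ (invmx T *m (invmx T)^T).
- by rewrite trmx_mul trmxK.
- move=> v v0; rewrite mulmxA -mulmxA -trmx_mul.
  set w := v *m _; have w0 : w != 0.
    by apply: contra v0 => /eqP w0; rewrite -(mulmxKV Tu v) -/w w0 mul0mx.
  rewrite -[w *m w^T]mulmx1 -[X in 0 < X](@trace_mx11 _ _) ?mulmx1.
  rewrite lt_neqAle mxtrace_mul_tr_ge0 andbT eq_sym.
  by apply: contra w0 => /eqP /mxtrace_mul_tr_eq0 ->.
move=> U triU UG; pose O := U *m invmx T.
have OO : O *m O^T = 1%:M by rewrite trmx_mul !mulmxA -UG !mulmxA.
exists U, O; split=> //.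
by have := soliton_rotate OO sol; rewrite /O mulmxKV.
Qed.

(** [P] and [Q] are rectangular because the sizes of two congruent pencils are in general not
    convertible; their equality is recovered from ranks. *)
Lemma soliton_congr N M p (J : 'I_p -> 'M[R]_N) (K : 'I_p -> 'M[R]_M)
    (P : 'M_(M, N)) (Q : 'M_(N, M)) T h lam E :
  P *m Q = 1%:M -> Q *m P = 1%:M -> (forall k, K k = P *m J k *m P^T) ->
  soliton_eqs J T h lam E ->
  exists T' E', (E = 0 -> E' = 0) /\ soliton_eqs K T' h lam E'.
Proof.
move=> PQ QP KE sol.
have eNM : M = N.
  apply/eqP; rewrite eqn_leq; apply/andP; split.
    by rewrite -(mxrank1 R M) -PQ (leq_trans (mxrankM_maxl _ _)) ?rank_leq_col.
  by rewrite -(mxrank1 R N) -QP (leq_trans (mxrankM_maxl _ _)) ?rank_leq_col.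
move: eNM => eNM; subst M.
have JE k : J k = Q *m K k *m Q^T.
  by rewrite KE !mulmxA QP mul1mx -mulmxA -trmx_mul QP trmx1 mulmx1.
have combE k : congr_comb J T h k = congr_comb K (T *m Q) h k.
  by apply: eq_bigr => l _; rewrite JE trmx_mul !mulmxA.
exists (T *m Q), E; split=> //; case: sol => Tu hu sE sqrE antiE; split=> //.
- by rewrite unitmx_mul Tu; case/mulmx1_unit: QP.
- by rewrite -sqrE; apply: eq_bigr => k _; rewrite combE.
- by move=> k; rewrite -combE.
Qed.

(** Anticommutation and cyclicity give tr (E M_k^2) = - tr (E M_k^2); then the first soliton
    equation is multiplied by [E]. *)
Lemma soliton_trace N p (J : 'I_p -> 'M[R]_N) T h lam E : soliton_eqs J T h lam E ->
  lam * \tr E + 2 * \tr (E *m E) = 0.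
Proof.
case=> Tu hu sE sqrE antiE.
have : \tr (E *m \sum_k congr_comb J T h k *m congr_comb J T h k) = 0.
  rewrite mulmx_sumr linear_sum big1 // => k _ /=.
  set M := congr_comb J T h k.
  have EM : E *m M = - (M *m E) by apply/eqP; rewrite -addr_eq0 antiE.
  have : \tr (E *m (M *m M)) = - \tr (E *m (M *m M)).
    by rewrite {1}mulmxA EM mulNmx linearN /= -mulmxA mxtrace_mulC mulmxA.
  lra.
by rewrite sqrE mulmxDr -scalemxAr linearD linearZ /= mul_mx_scalar linearZ.
Qed.

End SolitonEquations.

Lemma sum2 (V : nmodType) (f : 'I_2 -> V) : \sum_i f i = f 0 + f 1.
Proof.
by rewrite !big_ord_recl big_ord0 addr0; congr (f _ + f _); apply: val_inj.
Qed.

(** * What a simple nonreal root imposes on a derivation *)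

Section ComplexRoot.
Variables (R : realType) (N : nat) (J : 'I_2 -> 'M[R]_N).

(* [X + iY] and [X' + iY'] lie in the kernel of [J 0 + i tau (J 1)], and the   *)
(* pairing by [J 1] does not vanish on them: the root [i tau] has a Jordan     *)
(* block of size 1.                                                            *)
Definition simple_root (tau : R) : Prop := exists X Y X' Y' : 'rV[R]_N,
  [/\ [/\ tau != 0, X *m J 0 = tau *: (Y *m J 1) & Y *m J 0 = - tau *: (X *m J 1)],
      X' *m J 0 = tau *: (Y' *m J 1) /\ Y' *m J 0 = - tau *: (X' *m J 1),
      mxform (J 1) X X' = mxform (J 1) Y Y' &
      mxform (J 1) X Y' + mxform (J 1) Y X' != 0].

Hypothesis J_skew : forall k, (J k)^T = - J k.

(** Put u = X + iY and u' = X' + iY'. Adding the equation for l = 0 and i tau times the one for l =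
    1, evaluated at (u, u'), makes the left side vanish, as both vectors are killed by J_0 + i tau
    J_1. The right side is (d_10 + tau^2 d_01 + i tau (d_11 - d_00)) J_1(u, u'), and J_1(u, u') is
    nonzero. *)
Lemma simple_root_deriv tau (E : 'M[R]_N) (d : 'M[R]_2) : simple_root tau ->
  (forall l, E *m J l + J l *m E^T = \sum_q d q l *: J q) ->
  d 1 1 = d 0 0 /\ d 1 0 = - (tau ^+ 2 * d 0 1).
Proof.
case=> X [Y [X' [Y' [[tau0 X0 Y0] [X'0 Y'0] req q0]]]] eqn.
have ev l u v : mxform (E *m J l) u v + mxform (J l *m E^T) u v =
    d 0 l * mxform (J 0) u v + d 1 l * mxform (J 1) u v.
  have := congr1 (fun A => mxform A u v) (eqn l).
  by rewrite /mxform sum2 !mulmxDr !mulmxDl -!scalemxAr -!scalemxAl !mxE.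
have colr A c v w : v *m J 0 = c *: (w *m J 1) ->
    mxform (A *m J 0) ^~ v =1 (fun u => c * mxform (A *m J 1) u w).
  move=> vw u; rewrite /mxform.
  have vT : J 0 *m v^T = c *: (J 1 *m w^T).
    apply: trmx_inj; rewrite linearZ /= !trmx_mul !trmxK !J_skew !mulmxN vw.
    by rewrite scalerN.
  by rewrite -!mulmxA vT -!scalemxAr mxE.
have rowl A c v w : v *m J 0 = c *: (w *m J 1) ->
    mxform (J 0 *m A) v =1 (fun u => c * mxform (J 1 *m A) w u).
  by move=> vw u; rewrite /mxform !mulmxA vw -!scalemxAl mxE.
have rowl1 c v w : v *m J 0 = c *: (w *m J 1) -> mxform (J 0) v =1 (fun u => c * mxform (J 1) w u).
  by move=> vw u; rewrite /mxform vw -!scalemxAl mxE.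
(* [e1] to [e4] combine into the real part of the complex identity, [f1] to [f4] into its imaginary
   part. *)
have := (ev 0 X X', ev 0 Y Y', ev 1 X Y', ev 1 Y X').
rewrite !(colr _ _ _ _ X'0) !(colr _ _ _ _ Y'0) !(rowl _ _ _ _ X0) !(rowl _ _ _ _ Y0).
rewrite !(rowl1 _ _ _ X0) !(rowl1 _ _ _ Y0) => -[[[e1 e2] e3] e4].
have := (ev 0 X Y', ev 0 Y X', ev 1 X X', ev 1 Y Y').
rewrite !(colr _ _ _ _ X'0) !(colr _ _ _ _ Y'0) !(rowl _ _ _ _ X0) !(rowl _ _ _ _ Y0).
rewrite !(rowl1 _ _ _ X0) !(rowl1 _ _ _ Y0) => -[[[f1 f2] f3] f4].
move: req q0 e1 e2 e3 e4 f1 f2 f3 f4.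
move: (mxform (J 1) X X') (mxform (J 1) Y Y') (mxform (J 1) X Y') (mxform (J 1) Y X').
move: (mxform _ X X') (mxform _ Y Y') (mxform _ X Y') (mxform _ Y X').
move: (mxform _ X X') (mxform _ Y Y') (mxform _ X Y') (mxform _ Y X').
move: (d 0 0) (d 0 1) (d 1 0) (d 1 1) => a b c e.
move=> p1 p2 p3 p4 p5 p6 p7 p8 r1 r2 r3 r4 req q0 e1 e2 e3 e4 f1 f2 f3 f4.
have tq0 : tau * (r3 + r4) != 0 by rewrite mulf_neq0.
subst r1.
have {}e3 := congr1 ( *%R tau) e3; have {}e4 := congr1 ( *%R tau) e4.
have {}f3 := congr1 ( *%R tau) f3; have {}f4 := congr1 ( *%R tau) f4.
have E1 : tau * (r3 + r4) * (e - a) = 0 by lra.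
have E2 : (r3 + r4) * (c + tau ^+ 2 * b) = 0 by lra.
move: E1 E2 => /eqP; rewrite mulf_eq0 (negPf tq0) subr_eq0 => /eqP-> /eqP.
by rewrite mulf_eq0 (negPf q0) addr_eq0 => /eqP.
Qed.

(* The discriminant of the symmetric [k] is a sum of squares, whereas that of *)
(* [d], which is similar to [k], is [- (2 * tau * d 0 1) ^+ 2].               *)
Lemma similar_sym_scalar tau (h k d : 'M[R]_2) : h \in unitmx -> k^T = k ->
  d *m h = h *m k -> d 1 1 = d 0 0 -> d 1 0 = - (tau ^+ 2 * d 0 1) ->
  k = (k 0 0)%:M.
Proof.
move=> hu sk dh d11 d10.
have dE : d = h *m k *m invmx h by rewrite -dh mulmxK.
have t1 : \tr d = \tr k by rewrite dE mxtrace_mulC mulmxA mulVmx // mul1mx.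
have t2 : \tr (d *m d) = \tr (k *m k).
  by rewrite dE -!mulmxA mulKmx // mxtrace_mulC -!mulmxA mulVmx // mulmx1.
have k10 : k 1 0 = k 0 1 by rewrite -{1}sk mxE.
move: t1 t2; rewrite /mxtrace !sum2 !mxE !sum2 d11 d10 k10 => t1 t2.
have : (k 0 0 - k 1 1) ^+ 2 + 4 * k 0 1 ^+ 2 <= 0.
  have -> : (k 0 0 - k 1 1) ^+ 2 + 4 * k 0 1 ^+ 2 =
    2 * (k 0 0 * k 0 0 + k 0 1 * k 0 1 + (k 0 1 * k 0 1 + k 1 1 * k 1 1)) -
    (k 0 0 + k 1 1) ^+ 2 by ring.
  rewrite -t1 -t2; have := sqr_ge0 (tau * d 0 1); nra.
have := sqr_ge0 (k 0 0 - k 1 1); have := sqr_ge0 (k 0 1) => s1 s2 s3.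
have /eqP := (ltac:(lra) : (k 0 0 - k 1 1) ^+ 2 = 0).
have /eqP := (ltac:(lra) : k 0 1 ^+ 2 = 0).
rewrite !sqrf_eq0 subr_eq0 => /eqP k01 /eqP k00.
apply/matrixP => i j; rewrite [RHS]mxE.
have ord2 (l : 'I_2) : l = 0 \/ l = 1.
  by case: l => -[|[|//]] ?; [left|right]; apply: val_inj.
by case: (ord2 i) => ->; case: (ord2 j) => ->; rewrite ?k10 ?k01 ?k00.
Qed.

Lemma nilsoliton_eqs tau : simple_root tau ->
  (exists ip, nilsoliton (bracket_of (mu_of J)) ip) ->
  exists T h lam E, soliton_eqs J T h lam E.
Proof.
move=> root /(nilsoliton_congr_comb J_skew).
move=> [T [h [c [E [d [Tu hu sE sd [sqrE derE]]]]]]].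
(* Back in the original basis, where the root is given; [d'] is no longer symmetric but still
   similar to [d]. *)
pose E' := invmx T *m E *m T; pose d' := h *m d *m invmx h.
have d'h : d' *m h = h *m d by rewrite /d' mulmxKV.
have E'J l : E' *m J l + J l *m E'^T = \sum_q d' q l *: J q.
  apply/eqP; rewrite -subr_eq0; apply/eqP.
  set X := (X in X = 0).
  suff : T *m X *m T^T = 0.
    move/(congr1 (fun A => invmx T *m A *m (invmx T)^T)).
    rewrite mulmx0 mul0mx !mulmxA mulVmx // mul1mx -mulmxA -trmx_mul mulVmx //.
    by rewrite trmx1 mulmx1.
  move: l @X; apply: (comb_eq0 hu) => k /=.
  have -> : \sum_l h l k *: (T *m (E' *m J l + J l *m E'^T - \sum_q d' q l *: J q) *m T^T)
     = (E *m congr_comb J T h k + congr_comb J T h k *m E)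
       - \sum_q (d' *m h) q k *: (T *m J q *m T^T).
    rewrite !mulmx_sumr mulmx_suml -big_split.
    transitivity (\sum_l (h l k *: (E *m T *m J l *m T^T + T *m J l *m T^T *m E) -
       h l k *: \sum_q d' q l *: (T *m J q *m T^T))).
      apply: eq_bigr => l _; rewrite -scalerBr; congr (_ *: _).
      rewrite mulmxBr mulmxBl mulmxDr mulmxDl mulmx_sumr mulmx_suml; congr (_ - _).
        by rewrite /E' !trmx_mul sE !mulmxA mulmxV // mul1mx; congr (_ + _);
           rewrite -!mulmxA -trmx_mul mulmxV // trmx1 mulmx1.
      by apply: eq_bigr => q _; rewrite -scalemxAr -scalemxAl.
    rewrite sumrB; congr (_ - _).
      by apply: eq_bigr => l _; rewrite -scalemxAr -scalemxAl scalerDr !mulmxA.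
    under eq_bigr => l _ do rewrite scaler_sumr.
    rewrite exchange_big; apply: eq_bigr => q _ /=; rewrite mxE scaler_suml.
    by apply: eq_bigr => l _; rewrite scalerA mulrC.
  rewrite derE d'h; apply/eqP; rewrite subr_eq0; apply/eqP.
  under eq_bigr => l _ do rewrite scaler_sumr.
  rewrite exchange_big; apply: eq_bigr => q _ /=; rewrite mxE scaler_suml.
  by apply: eq_bigr => l _; rewrite scalerA mulrC.
have [d11 d10] := simple_root_deriv root E'J.
have dE := similar_sym_scalar hu sd d'h d11 d10.
set s := d 0 0 in dE.
(* Now E M_k + M_k E = s M_k. Removing s / 2 from [E] gives anticommutation and adds s to the
   constant 2 c. *)
exists T, h, (2 * c + s), (E - (s / 2)%:M); split=> //.
- by rewrite linearB /= sE tr_scalar_mx.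
- rewrite sqrE; apply/matrixP => i j; rewrite !mxE.
  by case: (i == j); rewrite ?mulr1n ?mulr0n; field.
- move=> k; rewrite mulmxBl mulmxBr addrACA derE dE -opprD mul_scalar_mx mul_mx_scalar.
  rewrite -scalerDl -splitr; apply/eqP; rewrite subr_eq0; apply/eqP.
  rewrite (bigD1 k) //= big1 ?addr0 => [|l /negPf lk]; first by rewrite mxE eqxx.
  by rewrite mxE lk scale0r.
Qed.

End ComplexRoot.

(** * Regular pencils, and the obstruction from a Jordan block of size two *)

Section Regular.
Variable R : realType.

Lemma soliton_anti_l N p (J : 'I_p -> 'M[R]_N) T h lam E l : soliton_eqs J T h lam E ->
  E *m (T *m J l *m T^T) + (T *m J l *m T^T) *m E = 0.
Proof.
case=> Tu hu sE sqrE antiE; move: l.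
apply: (comb_eq0 hu) => k; rewrite -[RHS](antiE k) /congr_comb mulmx_sumr mulmx_suml.
by rewrite -big_split /=; apply: eq_bigr => l _; rewrite -scalemxAr -scalemxAl scalerDr.
Qed.

(** An invertible member of the pencil conjugates [E] to [- E], whence the trace zero; [E] being
    symmetric, tr (E^2) = 0 suffices. *)
Lemma soliton_regular N p (J : 'I_p -> 'M[R]_N) T h lam E l :
  J l \in unitmx -> soliton_eqs J T h lam E -> E = 0.
Proof.
move=> Ju sol; have anti := soliton_anti_l l sol; have tr := soliton_trace sol.
have [Tu _ sE _ _] := sol; set G := T *m _ *m _ in anti.
have Gu : G \in unitmx by rewrite !unitmx_mul Tu Ju unitmx_tr.
have trE : \tr E = - \tr E.
  rewrite -{1}(mulmxK Gu E); move/eqP: anti; rewrite addr_eq0 => /eqP ->.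
  by rewrite mulNmx linearN /= mxtrace_mulC mulKmx.
apply: mxtrace_mul_tr_eq0; rewrite sE.
have /eqP : \tr E = 0 by lra.
move=> /eqP trE0; move: tr; rewrite trE0; lra.
Qed.

Lemma upper_mx3 n1 n2 n3 (T : 'M[R]_(n1 + (n2 + n3))) :
  (forall i j : 'I__, (j < i)%N -> T i j = 0) -> T \in unitmx ->
  exists a b c e f i, [/\ T = mx3 a b c 0 e f 0 0 i, a \in unitmx, e \in unitmx & i \in unitmx].
Proof.
have [a [b [c [d [e [f [g [h [i TE]]]]]]]]] := mx3_eta T.
move=> triT.
have d0 : col_mx d g = 0.
  have -> : col_mx d g = dlsubmx T by rewrite TE /mx3 block_mxKdl.
  by apply/matrixP => k l; rewrite !mxE triT //= ltn_addr.
have h0 : h = 0.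
  have -> : h = dlsubmx (drsubmx T) by rewrite TE /mx3 block_mxKdr block_mxKdl.
  by apply/matrixP => k l; rewrite !mxE triT //= ltn_add2l ltn_addr.
move: d0 => /eqP; rewrite col_mx_eq0 => /andP[/eqP d0 /eqP g0].
rewrite unitmxE TE d0 h0 g0 /mx3 col_mx0 !det_ublock !unitrM -!unitmxE => /and3P[? ? ?].
by exists a, b, c, e, f, i.
Qed.

(* Two diagonal blocks of [\sum_k M_k ^ 2] have the same trace, which kills   *)
(* the blocks (1,1) and (1,2) of all [M_k].  Read in the original basis this   *)
(* expresses [F l] as [- (Z *m B l + B l *m Y)], and [invmx (B 1) *m F 0 = 1]  *)
(* becomes a commutator.                                                       *)
Lemma jordan_not_einstein n m (F B : 'I_2 -> 'M[R]_n) (C : 'I_2 -> 'M[R]_m) T h lam :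
  (0 < n)%N -> (forall k, (F k)^T = - F k) ->
  (forall k, (B k)^T = - B k) -> (forall k, (C k)^T = - C k) ->
  B 1 \in unitmx -> F 0 = B 1 -> F 1 = 0 ->
  ~ soliton_eqs (fun k => mx3 (F k) 0 (B k) 0 (C k) 0 (B k) 0 (0 : 'M_n)) T h lam 0.
Proof.
move=> n0 sF sB sC Bu F0 F1 /soliton_upper[U [O [triU OO]]].
rewrite mulmx0 mul0mx => -[Uu hu _ sqrE _].
have [a [b [c [e [f [i [UE au eu iu]]]]]]] := upper_mx3 triU Uu.
set J := (fun k => mx3 _ _ _ _ _ _ _ _ _) in sqrE.
pose F' l := a *m F l *m a^T + c *m B l *m a^T + b *m C l *m b^T + a *m B l *m c^T.
pose D' l := b *m C l *m e^T + a *m B l *m f^T.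
have UJU l : exists X Y Z, U *m J l *m U^T =
    mx3 (F' l) (D' l) X (- (D' l)^T) Y 0 Z 0 0 /\ Z = - X^T.
  exists (a *m B l *m i^T), (e *m C l *m e^T), (i *m B l *m a^T).
  split; last by rewrite !trmx_mul trmxK sB mulNmx mulmxN opprK mulmxA.
  rewrite UE tr_mx3 !trmx0 !mul_mx3 !mulmx0 !mul0mx !addr0 !add0r.
  rewrite /F' /D' !mulmxDl linearD /= opprD !trmx_mul !trmxK sC sB.
  by rewrite !mulNmx !mulmxN !opprK !mulmxA; congr mx3; rewrite ?mul0mx ?addr0 // addrC.
have sF' l : (F' l)^T = - F' l.
  rewrite /F' !linearD /= !trmx_mul !trmxK sF sB sC !mulNmx !mulmxN !mulmxA -!opprD.
  by congr (- _); rewrite -!addrA; congr (_ + _); rewrite [LHS]addrC -[LHS]addrA [LHS]addrCA.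
pose Fk k := \sum_l h l k *: F' l; pose Dk k := \sum_l h l k *: D' l.
have ME k : exists X Y, congr_comb J U h k =
    mx3 (Fk k) (Dk k) X (- (Dk k)^T) Y 0 (- X^T) 0 0.
  rewrite /congr_comb sum2.
  have [X0 [Y0 [_ [-> ->]]]] := UJU 0; have [X1 [Y1 [_ [-> ->]]]] := UJU 1.
  exists (h 0 k *: X0 + h 1 k *: X1), (h 0 k *: Y0 + h 1 k *: Y1).
  rewrite /Fk /Dk !sum2; move: (F' 0) (F' 1) (D' 0) (D' 1) => f0 f1 d0 d1.
  by rewrite !scale_mx3 add_mx3 !scaler0 !addr0 !linearD /= !linearZ /= ?scalerN.
have sFk k : (Fk k)^T = - Fk k.
  rewrite /Fk !sum2; move: (F' 0) (F' 1) (sF' 0) (sF' 1) => f0 f1 s0 s1.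
  by rewrite linearD !linearZ /= s0 s1 !scalerN opprD.
have [FD0 DD0] : (forall k, Fk k = 0) /\ (forall k, Dk k = 0).
  move: sqrE; rewrite sum2.
  have [X0 [Y0 ->]] := ME 0; have [X1 [Y1 ->]] := ME 1.
  rewrite scaler0 addr0 mx3_scalar !mul_mx3 add_mx3 => /mx3_inj[[e11 _ _] _ [_ _ e33]].
  have {e11 e33} := congr1 mxtrace (etrans e11 (esym e33)).
  rewrite !linearD /= !mul0mx !mxtrace0 !mulmxN !mulNmx !linearN /= !addr0.
  rewrite (mxtrace_mulC X0) (mxtrace_mulC X1).
  rewrite -{1}[Fk 0]opprK -{1}[Fk 1]opprK -!sFk !mulNmx !linearN /=.
  rewrite !(mxtrace_mulC (_ ^T)) => tr0.
  have f0 := mxtrace_mul_tr_ge0 (Fk 0); have f1 := mxtrace_mul_tr_ge0 (Fk 1).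
  have d0 := mxtrace_mul_tr_ge0 (Dk 0); have d1 := mxtrace_mul_tr_ge0 (Dk 1).
  by split; apply: sum_mxtrace_mul_tr_eq0; rewrite sum2; lra.
have D0 : forall l, D' l = 0 := comb_eq0 hu DD0.
have F'0 : forall l, F' l = 0 := comb_eq0 hu FD0.
(* [D' l = 0] is solved for [b *m C l] and substituted into [F' l = 0]. After cancelling [a], the
   factors [Z] and [Y] no longer depend on [l]. *)
pose Z := invmx a *m c.
pose Y := (c^T - f^T *m (invmx e)^T *m b^T) *m (invmx a)^T.
have FE l : F l = - (Z *m B l + B l *m Y).
  apply/eqP; rewrite -addr_eq0; apply/eqP.
  have bC : b *m C l = - (a *m B l *m f^T *m (invmx e)^T).
    apply/eqP; rewrite -addr_eq0; apply/eqP.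
    have := congr1 (fun A => A *m (invmx e)^T) (D0 l).
    rewrite /D' mul0mx mulmxDl -[_ *m e^T *m _]mulmxA -trmx_mul mulVmx //.
    by rewrite trmx1 mulmx1.
  have := congr1 (fun A => invmx a *m A *m (invmx a)^T) (F'0 l).
  have aK (A : 'M_n) : A *m a^T *m (invmx a)^T = A.
    by rewrite -mulmxA -trmx_mul mulVmx // trmx1 mulmx1.
  rewrite /F' bC mulmx0 mul0mx !mulmxDr !mulmxDl !mulNmx !mulmxN !mulNmx !mulmxA.
  rewrite !aK mulVmx // !mul1mx => <-.
  rewrite /Y /Z mulmxBr mulmxBl !mulmxA -!addrA; congr (_ + (_ + _)).
  by rewrite addrC.
have Z1 : Z *m B 1 = - (B 1 *m Y).
  by apply/eqP; rewrite -addr_eq0 -[X in X == _]opprK -FE F1 oppr0.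
have : \tr (invmx (B 1) *m F 0) = 0.
  rewrite FE; have -> : Z = - (B 1 *m Y *m invmx (B 1)) by rewrite -mulNmx -Z1 mulmxK.
  rewrite mulmxN linearN mulmxDr linearD /= mulNmx mulmxN -!mulmxA mulKmx //.
  rewrite linearN /= [in X in _ + X]mulmxA [X in _ + X]mxtrace_mulC.
  by rewrite /Y !mulmxA addNr oppr0.
by rewrite F0 mulVmx // mxtrace1 => /eqP; rewrite pnatr_eq0 -leqn0 leqNgt n0.
Qed.

End Regular.

(** * Splitting off a block epsilon = 1 *)

Section HeisenbergBlock.
Variable R : realType.

Let mxtraceN n (A : 'M[R]_n) : \tr (- A) = - \tr A.
Proof. exact: linearN. Qed.

Lemma skew_mx11 (A : 'M[R]_1) : A^T = - A -> A = 0.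
Proof.
move=> sA; apply/matrixP => i j; rewrite !ord1 mxE.
by have := congr1 (fun B : 'M_1 => B 0 0) sA; rewrite !mxE; lra.
Qed.

Lemma ord2P (l : 'I_2) : l = 0 \/ l = 1.
Proof. by case: l => -[|[|//]] ?; [left|right]; apply: val_inj. Qed.

(** The equation reads x (lam - 6 x) = 2 q. A positive lam - 6 x would force x >= 0, but together
    with lam <= 2 x it forces x < 0. In the application [q], lam - 6 x and - 2 lam + 4 x are sums of
    squares. *)
Lemma heis_sum_arith (lam x q : R) : 0 <= q -> 0 <= lam - 6 * x ->
  0 <= - 2 * lam + 4 * x -> - lam * x + 6 * x ^+ 2 + 2 * q = 0 ->
  lam - 6 * x = 0 /\ q = 0.
Proof.
move=> q0 X0 Y0 eq; have xX : x * (lam - 6 * x) = 2 * q by lra.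
have X1 : lam - 6 * x = 0.
  apply: le_anti; rewrite X0 andbT leNgt; apply/negP => X1.
  have : 0 <= x by rewrite -(pmulr_lge0 _ X1) xX mulr_ge0.
  lra.
by split=> //; move: xX; rewrite X1; lra.
Qed.

Variables (m : nat) (K : 'I_2 -> 'M[R]_m) (b : 'I_2 -> 'rV[R]_2).
Hypothesis K_skew : forall k, (K k)^T = - K k.
Hypothesis K_unit : K 1 \in unitmx.
Hypothesis b0 : b 0 = - delta_mx 0 1.
Hypothesis b1 : b 1 = - delta_mx 0 0.

(* The block of [Eps 1] in the basis (X_3, X_1, X_2), with [K] inserted in the *)
(* middle so that the last summand is isotropic.                               *)
Definition heis_sum k : 'M[R]_(1 + (m + 2)) :=
  mx3 0 0 (b k) 0 (K k) 0 (- (b k)^T) 0 0.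

Lemma heis_sum_skew k : (heis_sum k)^T = - heis_sum k.
Proof. by rewrite tr_mx3 opp_mx3 !trmx0 !oppr0 opprK linearN /= trmxK K_skew. Qed.

(** The vectors [b 0], [b 1] span the row space and [K 1] is invertible: together they make [E]
    preserve the block flag and tie its last diagonal block to its first. *)
Lemma heis_sum_deriv (E : 'M[R]_(1 + (m + 2))) :
  (forall l, E *m heis_sum l + heis_sum l *m E^T = 0) ->
  exists (x : R) p q e r, E = mx3 x%:M p q 0 e r 0 0 (- x%:M) /\ \tr e = 0.
Proof.
have [e11 [e12 [e13 [e21 [e22 [e23 [e31 [e32 [e33 ->]]]]]]]]] := mx3_eta E.
move=> eqn.
have {eqn} eqs l : [/\ e11 *m b l + b l *m e33^T = 0, e22 *m K l + K l *m e22^T = 0,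
    e21 *m b l + K l *m e32^T = 0 & e31 *m b l - (b l)^T *m e31^T = 0].
  move: (eqn l); rewrite tr_mx3 !mul_mx3 !mulmx0 !mul0mx !addr0 !add0r add_mx3.
  rewrite (mx3_0 _ 1 m 2) mulNmx => /mx3_inj[[_ _ e13E] [_ e22E e23E] [_ _ e33E]].
  by split; rewrite -?mulNmx.
have e31_0 : e31 = 0.
  have [_ _ _ /(congr1 (fun A : 'M_2 => A 0 1))] := eqs 0.
  have [_ _ _ /(congr1 (fun A : 'M_2 => A 1 0))] := eqs 1.
  rewrite b0 b1 !mxE !big_ord_recl !big_ord0 !mxE !ord1 /= => h1 h2.
  apply/matrixP => i j; rewrite ord1 mxE.
  by case: (ord2P i) => ->; lra.
have e21_0 : e21 = 0.
  have [_ _ E0 _] := eqs 0; have [_ _ E1 _] := eqs 1.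
  have e32E : e32^T = - (invmx (K 1) *m (e21 *m b 1)).
    rewrite -[LHS](mulKmx K_unit) -mulmxN; congr (_ *m _); apply/eqP.
    by rewrite -addr_eq0 addrC E1.
  (* [v] is annihilated by [b 1] and paired to -1 with [b 0]. Once [e32] is eliminated through the
     equation for l = 1, multiplying the one for l = 0 by [v] leaves [- e21] alone. *)
  pose v : 'cV[R]_2 := delta_mx 1 0.
  have v0 : b 0 *m v = - 1%:M.
    by rewrite b0 mulNmx mul_delta_mx; congr (- _); apply/matrixP => i j; rewrite !ord1 !mxE.
  have v1 : b 1 *m v = 0 by rewrite b1 mulNmx mul_delta_mx_0 ?oppr0.
  have := congr1 (fun A => A *m v) E0.
  rewrite e32E mul0mx mulmxDl -!mulmxA mulNmx -!mulmxA v0 v1 !mulmx0 oppr0 mulmx0 addr0.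
  by rewrite mulmxN mulmx1 => /eqP; rewrite oppr_eq0 => /eqP.
have e32_0 : e32 = 0.
  have [_ _ + _] := eqs 1; rewrite e21_0 mul0mx add0r => /(congr1 (mulmx (invmx (K 1)))).
  by rewrite mulKmx // mulmx0 => /(congr1 trmx); rewrite trmxK trmx0.
pose x := e11 0 0; have e11E : e11 = x%:M by rewrite [LHS]mx11_scalar.
have e33E : e33 = - x%:M.
  apply: trmx_inj; rewrite linearN /= tr_scalar_mx; apply/row_matrixP => i.
  rewrite !rowE; have : exists l, delta_mx 0 i = - b l.
    by case: (ord2P i) => ->; [exists 1; rewrite b1 opprK | exists 0; rewrite b0 opprK].
  case=> l ->; have [/eqP + _ _ _] := eqs l.
  rewrite e11E mul_scalar_mx addrC addr_eq0 => /eqP bl.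
  by rewrite !mulNmx bl mulmxN mul_mx_scalar.
exists x, e12, e13, e22, e23; split; first by rewrite e21_0 e31_0 e32_0 e11E e33E.
have [_ /eqP + _ _] := eqs 1; rewrite addr_eq0 => /eqP eK.
have : \tr e22 = - \tr e22.
  by rewrite -{1}(mulmxK K_unit e22) eK mulNmx linearN /= mxtrace_mulC mulKmx // mxtrace_tr.
lra.
Qed.

Lemma heis_sum_soliton T h lam E : soliton_eqs heis_sum T h lam E ->
  exists T' lam', soliton_eqs K T' h lam' 0.
Proof.
case/soliton_upper => U [O [triU OO]]; move: (O *m E *m O^T) => {OO} E' sol.
have [Uu hu sE sqrE antiE] := sol; have trE := soliton_trace sol.
have [a [bb [c [e [f [i [UE au eu iu]]]]]]] := upper_mx3 triU Uu.
have [x [p [q [e22 [r [dE tr22]]]]]] : exists (x : R) p q e r,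
    invmx U *m E' *m U = mx3 x%:M p q 0 e r 0 0 (- x%:M) /\ \tr e = 0.
  apply: heis_sum_deriv => l; have := soliton_anti_l l sol.
  move/(congr1 (fun A => invmx U *m A *m (invmx U)^T)).
  rewrite mulmx0 mul0mx mulmxDr mulmxDl !mulmxA mulVmx // mul1mx => <-.
  rewrite !trmx_mul sE !mulmxA; congr (_ + _).
  by rewrite -[RHS]mulmxA -trmx_mul mulVmx // trmx1 mulmx1.
(* Conjugation by the block triangular [U] preserves block triangularity and the scalar diagonal
   blocks; symmetry then makes [E'] block diagonal. *)
have [E2 [E'E trE2 symE2]] : exists E2,
    [/\ E' = mx3 x%:M 0 0 0 E2 0 0 0 (- x%:M), \tr E2 = 0 & E2^T = E2].
  have EU : E' *m U = U *m mx3 x%:M p q 0 e22 r 0 0 (- x%:M).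
    by rewrite -dE !mulmxA mulmxV // mul1mx.
  have [f11 [f12 [f13 [f21 [f22 [f23 [f31 [f32 [f33 FE]]]]]]]]] := mx3_eta E'.
  move: EU; rewrite FE UE !mul_mx3 !mulmx0 !mul0mx !addr0 !add0r.
  move=> /mx3_inj[[g11 _ _] [g21 g22 _] [g31 g32 g33]].
  have f21_0 : f21 = 0 by rewrite -(mulmxK au f21) g21 mul0mx.
  have f31_0 : f31 = 0 by rewrite -(mulmxK au f31) g31 mul0mx.
  move: g22 g32 g33; rewrite f21_0 f31_0 !mul0mx !add0r => g22 g32.
  have f32_0 : f32 = 0 by rewrite -(mulmxK eu f32) g32 mul0mx.
  rewrite f32_0 mul0mx add0r mulmxN mul_mx_scalar => g33.
  have f33E : f33 = - x%:M by rewrite -(mulmxK iu f33) g33 mulNmx -scalemxAl mulmxV // scalemx1.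
  have f11E : f11 = x%:M.
    by rewrite -(mulmxK au f11) g11 mul_mx_scalar -scalemxAl mulmxV // scalemx1.
  have trf22 : \tr f22 = 0.
    by rewrite -(mulmxK eu f22) g22 mxtrace_mulC mulmxA mulVmx // mul1mx.
  move: sE; rewrite FE tr_mx3 => /mx3_inj[[_ s12 s13] [_ s22 s23] _].
  exists f22; split=> //.
  by rewrite f33E f11E -s12 -s13 -s23 f21_0 f31_0 f32_0 !trmx0.
have [X [Y ME]] : exists (X : 'I_2 -> 'rV[R]_m) (Y : 'I_2 -> 'rV[R]_2), forall k,
    congr_comb heis_sum U h k =
    mx3 0 (X k) (Y k) (- (X k)^T) (congr_comb K e h k) 0 (- (Y k)^T) 0 0.
  suff ME k : exists X Y, congr_comb heis_sum U h k =
      mx3 0 X Y (- X^T) (congr_comb K e h k) 0 (- Y^T) 0 0.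
    have [X0 [Y0 M0]] := ME 0; have [X1 [Y1 M1]] := ME 1.
    exists (fun k => if k == 0 then X0 else X1), (fun k => if k == 0 then Y0 else Y1) => k.
    by case: (ord2P k) => ->.
  have ME0 : exists G X Y H L, congr_comb heis_sum U h k =
      mx3 G X Y H (congr_comb K e h k) 0 L 0 0.
    have UJU l : exists G X Y H L, U *m heis_sum l *m U^T = mx3 G X Y H (e *m K l *m e^T) 0 L 0 0.
      rewrite UE tr_mx3 !trmx0 !mul_mx3 !mulmx0 !mul0mx !addr0 !add0r.
      by do 5 eexists; rewrite ?mul0mx ?addr0; reflexivity.
    rewrite /congr_comb !sum2.
    have [G0 [X0 [Y0 [H0 [L0 ->]]]]] := UJU 0; have [G1 [X1 [Y1 [H1 [L1 ->]]]]] := UJU 1.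
    rewrite !scale_mx3 add_mx3 !scaler0 !addr0.
    by do 5 eexists; reflexivity.
  have := congr_comb_skew heis_sum_skew U h k.
  have [G [X [Y [H [L ->]]]]] := ME0; rewrite tr_mx3 opp_mx3.
  move=> /mx3_inj[[/skew_mx11-> HX LY] _ _]; exists X, Y.
  by rewrite -[H]trmxK -[L]trmxK HX LY !linearN.
pose C k := congr_comb K e h k.
move: sqrE; rewrite sum2 !ME E'E mx3_scalar scale_mx3 !mul_mx3 !add_mx3.
move=> /mx3_inj[[s11 _ _] [_ s22 _] [_ _ s33]].
(* Traces of the first and last diagonal blocks, of sizes 1 and 2, of the equation for the sum of
   the M_k^2. *)
have SXY : \sum_k \tr (X k *m (X k)^T) = - lam - 2 * x - \sum_k \tr (Y k *m (Y k)^T).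
  move: (congr1 mxtrace s11); rewrite !sum2 mul0mx !mulmxN !mxtraceD !mxtraceN mxtrace0.
  rewrite mxtraceZ ?mxtraceN !mxtrace_scalar; lra.
have SY : \sum_k \tr (Y k *m (Y k)^T) = - 2 * lam + 4 * x.
  move: (congr1 mxtrace s33).
  rewrite !sum2 mulmx0 mul0mx !mulNmx !mxtraceD !mxtraceN mxtrace0.
  rewrite (mxtrace_mulC _ (Y 0)) (mxtrace_mulC _ (Y 1)) mxtraceZ ?mxtraceN !mxtrace_scalar.
  rewrite !mulr2n; lra.
pose Q := \tr (E2 *m E2^T); have Q0 : 0 <= Q := mxtrace_mul_tr_ge0 E2.
(* The identity [trE] with tr E' = x + 0 - 2 x and tr (E'^2) = 3 x^2 + Q. *)
have xQ : - lam * x + 6 * x ^+ 2 + 2 * Q = 0.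
  rewrite /Q symE2; move: trE; rewrite E'E !mul_mx3 !tr_mx3_trace trE2.
  rewrite !mulmx0 ?mul0mx !addr0 !add0r mulNmx mulmxN opprK mxtraceN.
  by rewrite -!scalar_mxM !mxtrace_scalar mulr1n !mulr2n => <-; ring.
have SX0 : 0 <= \sum_k \tr (X k *m (X k)^T).
  by apply: sumr_ge0 => k _; apply: mxtrace_mul_tr_ge0.
have SY0 : 0 <= \sum_k \tr (Y k *m (Y k)^T).
  by apply: sumr_ge0 => k _; apply: mxtrace_mul_tr_ge0.
have SXE : \sum_k \tr (X k *m (X k)^T) = lam - 6 * x by rewrite SXY SY; ring.
have [h1 h2] : lam - 6 * x = 0 /\ Q = 0.
  by apply: heis_sum_arith xQ; rewrite -?SXE -?SY.
have X0 : forall k, X k = 0 by apply: sum_mxtrace_mul_tr_eq0; rewrite SXE.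
have E20 : E2 = 0 := mxtrace_mul_tr_eq0 h2.
exists e, lam; split=> //.
- by rewrite trmx0.
- by move: s22; rewrite sum2 !X0 E20 !mulmx0 ?mul0mx !add0r !addr0.
- by move=> k; rewrite mulmx0 mul0mx addr0.
Qed.

End HeisenbergBlock.

(** * Type, centre, indecomposability and isomorphisms of the algebra of a pencil *)

Section PencilAlgebra.
Variables (R : realType) (N : nat) (J : 'I_2 -> 'M[R]_N).
Hypothesis J_skew : forall k, (J k)^T = - J k.

(** Equivalent to n2 being the whole centre of the bracket. *)
Definition nondeg_pencil := forall u : 'rV[R]_N, (forall k, u *m J k = 0) -> u = 0.

Lemma mxform_eq0 A : (forall u v : 'rV[R]_N, mxform A u v = 0) -> A = 0.
Proof.
move=> A0; apply/matrixP => i j; rewrite [RHS]mxE -(A0 (delta_mx 0 i) (delta_mx 0 j)).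
by rewrite /mxform -rowE trmx_delta -colE !mxE.
Qed.

Lemma center_bracket_of x : nondeg_pencil ->
  (forall y, bracket_of (mu_of J) y x = 0) -> lsubmx x = 0.
Proof.
move=> ndg cx; apply: ndg => k; apply/rowP => j; rewrite [RHS]mxE.
have := cx (row_mx (delta_mx 0 j) 0); rewrite /bracket_of row_mxKl => /eqP.
rewrite row_mx_eq0 => /andP[_ /eqP /(congr1 (fun v : 'rV_2 => v 0 k))].
by rewrite mu_ofE /mxform trmx_delta -colE !mxE.
Qed.

Variable tau : R.
Hypothesis root : simple_root J tau.

(** On the root vectors J_0 is expressed by J_1, so mu(X', X) - mu(Y', Y) and mu(X', Y) + mu(Y', X)
    are nonzero multiples of the two basis vectors. *)
Lemma mu_of_span (W : {vspace 'rV[R]_2}) : (forall X Y, mu_of J X Y \in W) -> W = fullv.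
Proof.
move=> muW; have [X [Y [X' [Y' [[tau0 X0 Y0] _ req q0]]]]] := root.
set q := _ + _ in q0.
have rowl c v w : v *m J 0 = c *: (w *m J 1) ->
    mxform (J 0) v =1 (fun u => c * mxform (J 1) w u).
  by move=> vw u; rewrite /mxform vw -!scalemxAl mxE.
have muE u v : mu_of J u v = \row_k (if k == 0 then mxform (J 0) v u else mxform (J 1) v u).
  by apply/rowP => k; rewrite mu_ofE mxE; case: (ord2P k) => ->.
have d0 : delta_mx 0 0 \in W.
  have -> : delta_mx 0 0 = (tau * q)^-1 *: (mu_of J X' X - mu_of J Y' Y) :> 'rV[R]_2.
    rewrite !muE (rowl _ _ _ X0) (rowl _ _ _ Y0) req; apply/rowP => k; rewrite !mxE.
    case: (ord2P k) => -> /=; last by rewrite subrr mulr0.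
    by rewrite mulNr opprK -mulrDr addrC mulVf // mulf_neq0.
  by rewrite memvZ // memvB.
have d1 : delta_mx 0 1 \in W.
  have -> : delta_mx 0 1 = q^-1 *: (mu_of J X' Y + mu_of J Y' X) :> 'rV[R]_2.
    rewrite !muE (rowl _ _ _ X0) (rowl _ _ _ Y0) req; apply/rowP => k; rewrite !mxE.
    case: (ord2P k) => -> /=; first by rewrite mulNr addNr mulr0.
    by rewrite addrC mulVf.
  by rewrite memvZ // memvD.
apply/vspaceP => v; rewrite memvf (row_sum_delta v); apply/idP.
by apply: memv_suml => k _; rewrite memvZ //; case: (ord2P k) => ->.
Qed.

Lemma mu_of_type : of_type 2 N (mu_of J).
Proof.
split=> //; [exact: mu_of_bilinear | exact: mu_of_skew | exact: mu_of_span].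
Qed.

Lemma bracket_of_two_step : two_step_nilpotent (bracket_of (mu_of J)).
Proof.
split; last exact: bracket_of_2step.
have [X [Y [X' [Y' [_ _ _ q0]]]]] := root.
have [u [v uv]] : exists u v, mxform (J 1) u v != 0.
  have [E|] := eqVneq (mxform (J 1) X Y') 0; last by exists X, Y'.
  by exists Y, X'; rewrite E add0r in q0.
exists (row_mx v 0), (row_mx u 0); rewrite /bracket_of !row_mxKl.
apply: contra uv; rewrite row_mx_eq0 => /andP[_ /eqP/rowP/(_ 1)].
by rewrite mu_ofE mxE => ->.
Qed.

(** If J_1(X, u) or J_1(Y, u) is nonzero, then [u, X] and [u, Y] span n2, their determinant being
    tau times a sum of two squares up to sign. An ideal containing such a [u] contains n2, and any
    complementary ideal is then central, hence inside n2, hence zero. So J_1(X, -) and J_1(Y, -)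
    vanish on both summands, against the nonzero pairing of the root. *)
Lemma bracket_of_indecomposable : nondeg_pencil -> indecomposable (bracket_of (mu_of J)).
Proof.
move=> ndg [U [V [[idU idV] [U0 V0] UV1 UV0]]].
set br := bracket_of _ in idU idV.
have br_skewJ : forall x y, br x y = - br y x := br_skew (bracket_of_lie J_skew).
have big (A B : {vspace 'rV[R]_(N + 2)}) : lie_ideal br B -> B != 0%VS ->
    (A :&: B)%VS = 0%VS -> ~ (forall w : 'rV_2, row_mx 0 w \in A).
  move=> idB + AB0 cA; apply/negP; rewrite negbK -subv0.
  apply/subvP => v vB.
  have v0 : lsubmx v = 0.
    apply: center_bracket_of ndg _ => y; apply/eqP; rewrite -memv0 -AB0 memv_cap.
    by rewrite idB // andbT; apply: cA.
  rewrite -AB0 memv_cap vB andbT -(hsubmxK v) v0; exact: cA.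
have [X [Y [X' [Y' [[tau0 X0 Y0] _ _ q0]]]]] := root.
pose f (u : 'rV_(N + 2)) := mxform (J 1) X (lsubmx u).
pose g (u : 'rV_(N + 2)) := mxform (J 1) Y (lsubmx u).
have small (A B : {vspace 'rV[R]_(N + 2)}) : lie_ideal br A -> lie_ideal br B -> B != 0%VS ->
    (A :&: B)%VS = 0%VS -> forall u, u \in A -> f u = 0 /\ g u = 0.
  move=> idA idB B0 AB0 u uA.
  have [D0|D0] := eqVneq (f u ^+ 2 + g u ^+ 2) 0.
    move/eqP: D0; rewrite paddr_eq0 ?sqr_ge0 // !sqrf_eq0 => /andP[/eqP-> /eqP->].
    by [].
  case: (big A B idB B0 AB0) => w.
  have bru v : br u (row_mx v 0) = row_mx 0 (\row_k mxform (J k) v (lsubmx u)).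
    by rewrite /br /bracket_of row_mxKl; congr row_mx; apply/rowP => k; rewrite mu_ofE mxE.
  have -> : row_mx 0 w =
     ((w 0 0 * g u + tau * f u * w 0 1) / (tau * (f u ^+ 2 + g u ^+ 2))) *: br u (row_mx X 0) +
     ((tau * g u * w 0 1 - w 0 0 * f u) / (tau * (f u ^+ 2 + g u ^+ 2))) *: br u (row_mx Y 0).
    rewrite !bru !scale_row_mx add_row_mx !scaler0 addr0; congr row_mx.
    apply/rowP => k; rewrite !mxE.
    case: (ord2P k) => ->; last first.
      rewrite -/(f u) -/(g u); field; exact/andP.
    have -> : mxform (J 0) X (lsubmx u) = tau * g u by rewrite /g /mxform X0 -scalemxAl mxE.
    have -> : mxform (J 0) Y (lsubmx u) = - tau * f u by rewrite /f /mxform Y0 -scalemxAl mxE.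
    field; exact/andP.
  by rewrite memvD // memvZ // br_skewJ memvN; apply: idA.
have fg u : f u = 0 /\ g u = 0.
  have : u \in (U + V)%VS by rewrite UV1 memvf.
  case/memv_addP => a aU [b bV ->].
  have [fa ga] := small U V idU idV V0 UV0 a aU.
  have [fb gb] := small V U idV idU U0 (etrans (capvC _ _) UV0) b bV.
  have lD Z : mxform (J 1) Z (lsubmx (a + b)) =
      mxform (J 1) Z (lsubmx a) + mxform (J 1) Z (lsubmx b).
    by rewrite linearD /= -[lsubmx a]scale1r mxformPr mul1r scale1r.
  by rewrite /f /g !lD; move: fa ga fb gb; rewrite /f /g => -> -> -> ->; rewrite addr0.
have [+ _] := fg (row_mx Y' 0); have [_ +] := fg (row_mx X' 0).
by rewrite /f /g !row_mxKl => e1 e2; rewrite e1 e2 addr0 eqxx in q0.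
Qed.

End PencilAlgebra.

(** Elements of n2 are central, and in the target the centre is n2, so the isomorphism is block
    triangular: [P] is its action on n1 modulo the centre and [g] its action on n2. *)
Lemma isomorphic_congr (R : realType) N M (J : 'I_2 -> 'M[R]_N) (K : 'I_2 -> 'M[R]_M) :
  (forall k, (K k)^T = - K k) -> nondeg_pencil K ->
  lie_isomorphic (bracket_of (mu_of J)) (bracket_of (mu_of K)) ->
  exists (P : 'M_(N, M)) (g : 'M_2), g \in unitmx /\
    forall l, P *m K l *m P^T = \sum_k g k l *: J k.
Proof.
move=> sK ndg [f [f' fK f'K] fbr].
pose F := lin1_mx f; have FE x : f x = x *m F by rewrite mul_rV_lin1.
pose P := ulsubmx F; pose g := drsubmx F.
have mu0 v y : bracket_of (mu_of J) y (row_mx 0 v) = 0.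
  rewrite /bracket_of row_mxKl -[RHS]row_mx0; congr row_mx; apply/rowP => k.
  by rewrite mu_ofE /mxform !mul0mx !mxE.
have F0 v : lsubmx (f (row_mx 0 v)) = 0.
  apply: (center_bracket_of ndg) => y; rewrite -(f'K y) -fbr mu0; exact: linear0.
have dl : dlsubmx F = 0.
  apply/row_matrixP => i; rewrite row0 -(F0 (delta_mx 0 i)) FE -[F]submxK.
  by rewrite mul_row_block !mul0mx !add0r row_mxKl block_mxKdl rowE.
have FB : F = block_mx P (ursubmx F) 0 g by rewrite -dl submxK.
exists P, g; split.
  rewrite -row_free_unit -kermx_eq0; apply/rowV0P => v /sub_kermxP vg.
  have : f (row_mx 0 v) = f 0.
    by rewrite linear0 FE FB mul_row_block !mul0mx mulmx0 add0r add0r vg row_mx0.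
  by move/(can_inj fK)/eqP; rewrite row_mx_eq0 => /andP[_ /eqP].
move=> l; apply/eqP; rewrite -subr_eq0; apply/eqP/mxform_eq0 => u v.
have := fbr (row_mx v 0) (row_mx u 0).
rewrite /bracket_of !FE FB !mul_row_block !mul0mx !row_mxKl !addr0 !mulmx0 add0r.
case/eq_row_mx => _ /rowP/(_ l); rewrite add0r [LHS]mxE sum2 !mu_ofE => E.
rewrite /mxform mulmxBr mulmxBl mxE [X in _ + X]mxE -!mulmxA.
move: E; rewrite /mxform trmx_mul -!mulmxA => <-.
rewrite sum2 mulmxDl mulmxDr -!scalemxAl -!scalemxAr [X in _ - X]mxE.
by rewrite [X in _ - (X + _)]mxE [X in _ - (_ + X)]mxE; ring.
Qed.

(** * Congruence and direct sums of pencils *)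

Section Pencils.
Variable R : realType.

Definition dsum N M (J : 'I_2 -> 'M[R]_N) (K : 'I_2 -> 'M[R]_M) k : 'M[R]_(N + M) :=
  block_mx (J k) 0 0 (K k).

Definition pencil_cong N M (J : 'I_2 -> 'M[R]_N) (K : 'I_2 -> 'M[R]_M) : Prop :=
  exists (P : 'M_(M, N)) (Q : 'M_(N, M)),
    [/\ P *m Q = 1%:M, Q *m P = 1%:M & forall k, K k = P *m J k *m P^T].

Lemma pencil_cong_refl N (J K : 'I_2 -> 'M[R]_N) : J =1 K -> pencil_cong J K.
Proof. by move=> JK; exists 1%:M, 1%:M; split=> [||k]; rewrite ?trmx1 ?mulmx1 ?mul1mx. Qed.

Lemma pencil_cong_trans N M L (J : 'I_2 -> 'M[R]_N) (K : 'I_2 -> 'M[R]_M) (H : 'I_2 -> 'M[R]_L) :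
  pencil_cong J K -> pencil_cong K H -> pencil_cong J H.
Proof.
move=> [P [Q [PQ QP KE]]] [P' [Q' [PQ' QP' HE]]]; exists (P' *m P), (Q *m Q').
split=> [||k]; last by rewrite HE KE trmx_mul !mulmxA.
  by rewrite -mulmxA (mulmxA P) PQ mul1mx.
by rewrite -mulmxA (mulmxA Q') QP' mul1mx.
Qed.

Lemma pencil_cong_sym N M (J : 'I_2 -> 'M[R]_N) (K : 'I_2 -> 'M[R]_M) :
  pencil_cong J K -> pencil_cong K J.
Proof.
move=> [P [Q [PQ QP KE]]]; exists Q, P; split=> // k.
by rewrite KE !mulmxA QP mul1mx -mulmxA -trmx_mul QP trmx1 mulmx1.
Qed.

Lemma dsum_cong N M N' M' (J : 'I_2 -> 'M[R]_N) (K : 'I_2 -> 'M[R]_M)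
    (J' : 'I_2 -> 'M[R]_N') (K' : 'I_2 -> 'M[R]_M') :
  pencil_cong J J' -> pencil_cong K K' -> pencil_cong (dsum J K) (dsum J' K').
Proof.
move=> [P [Q [PQ QP JE]]] [P' [Q' [PQ' QP' KE]]].
exists (block_mx P 0 0 P'), (block_mx Q 0 0 Q'); split=> [||k].
- by rewrite mulmx_block !mulmx0 ?mul0mx !addr0 !add0r PQ PQ' -scalar_mx_block.
- by rewrite mulmx_block !mulmx0 ?mul0mx !addr0 !add0r QP QP' -scalar_mx_block.
- rewrite /dsum tr_block_mx !trmx0 !mulmx_block !mulmx0 !mul0mx !addr0 !add0r ?mul0mx.
  by rewrite JE KE.
Qed.

Lemma dsumCA_cong N M L (J : 'I_2 -> 'M[R]_N) (K : 'I_2 -> 'M[R]_M) (H : 'I_2 -> 'M[R]_L) :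
  pencil_cong (dsum J (dsum K H)) (dsum K (dsum J H)).
Proof.
have dE A B C (X : 'I_2 -> 'M[R]_A) (Y : 'I_2 -> 'M[R]_B) (Z : 'I_2 -> 'M[R]_C) k :
    dsum X (dsum Y Z) k = mx3 (X k) 0 0 0 (Y k) 0 0 0 (Z k).
  by rewrite /dsum /mx3 row_mx0 col_mx0.
exists (mx3 0 1%:M 0 1%:M 0 0 0 0 1%:M), (mx3 0 1%:M 0 1%:M 0 0 0 0 1%:M).
split=> [||k]; rewrite ?dE ?tr_mx3 ?trmx1 ?trmx0 !mul_mx3;
  rewrite ?mulmx0 ?mul0mx ?mulmx1 ?mul1mx ?addr0 ?add0r ?mulmx0 ?mul0mx ?addr0 ?add0r.
- by rewrite -mx3_scalar.
- by rewrite -mx3_scalar.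
- by [].
Qed.

(** Inserts the other summand in the middle, so that the subspace carrying [D], isotropic in all
    uses, ends the flag. *)
Lemma dsum_block_cong n p m (A : 'I_2 -> 'M[R]_n) B C (D : 'I_2 -> 'M[R]_p) (K : 'I_2 -> 'M[R]_m) :
  pencil_cong (dsum (fun k => block_mx (A k) (B k) (C k) (D k)) K)
    (fun k => mx3 (A k) 0 (B k) 0 (K k) 0 (C k) 0 (D k)).
Proof.
pose r1 : 'M[R]_(n, n + p + m) := row_mx (row_mx 1%:M 0) 0.
pose r2 : 'M[R]_(m, n + p + m) := row_mx 0 1%:M.
pose r3 : 'M[R]_(p, n + p + m) := row_mx (row_mx 0 1%:M) 0.
pose P := col_mx r1 (col_mx r2 r3).
have mx3E a1 a2 a3 b1 b2 b3 (a : 'M[R]_(a1, b1)) b c d e f g h (i : 'M_(a3, b3)) :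
    mx3 (a : 'M_(a1, b1)) (b : 'M_(a1, b2)) c (d : 'M_(a2, b1)) e f g h i =
    col_mx (row_mx a (row_mx b c)) (col_mx (row_mx d (row_mx e f)) (row_mx g (row_mx h i))).
  by rewrite /mx3 block_mxEv; congr col_mx; rewrite block_mxEv -block_mxEh block_mxEv.
have PXP X : P *m X *m P^T = mx3 (r1 *m X *m r1^T) (r1 *m X *m r2^T) (r1 *m X *m r3^T)
    (r2 *m X *m r1^T) (r2 *m X *m r2^T) (r2 *m X *m r3^T)
    (r3 *m X *m r1^T) (r3 *m X *m r2^T) (r3 *m X *m r3^T).
  by rewrite mx3E /P !mul_col_mx !tr_col_mx !mul_mx_row.
have rE : [/\ r1^T = col_mx (col_mx 1%:M 0) 0, r2^T = col_mx 0 1%:M &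
    r3^T = col_mx (col_mx 0 1%:M) 0].
  by rewrite !tr_row_mx !trmx0 !trmx1.
have [r1E r2E r3E] := rE.
exists P, P^T; split=> [||k].
- rewrite -[P in P *m _]mulmx1 PXP !mulmx1 r1E r2E r3E.
  by rewrite /r1 /r2 /r3 !mul_row_col !mulmx0 !mul0mx !mul1mx !addr0 !add0r -mx3_scalar.
- rewrite /P !tr_col_mx !mul_row_col r1E r2E r3E /r1 /r2 /r3.
  rewrite !mul_col_row ?(mulmx0, mul0mx, mul1mx) ?block_mx0.
  rewrite !add_block_mx ?(addr0, add0r) ?add_block_mx ?(addr0, add0r).
  by rewrite -!scalar_mx_block.
- rewrite PXP r1E r2E r3E /r1 /r2 /r3 /dsum.
  rewrite !mul_row_block !mul_row_col.
  rewrite ?(mulmx0, mul0mx, mul1mx, mulmx1, addr0, add0r).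
  by rewrite !mul_row_col ?(mulmx0, mulmx1, addr0, add0r).
Qed.

Lemma dsum_antidiag_cong n m (P S : 'I_2 -> 'M[R]_n) (K : 'I_2 -> 'M[R]_m) :
  (forall k, (P k)^T = P k) -> (forall k, (S k)^T = S k) ->
  pencil_cong
    (dsum (fun k => block_mx 0 (block_mx 0 (P k) (P k) (S k))
                             (- (block_mx 0 (P k) (P k) (S k))^T) 0) K)
    (fun k => mx3 (block_mx 0 (S k) (- S k) 0) 0 (block_mx 0 (P k) (- P k) 0) 0 (K k) 0
                  (block_mx 0 (P k) (- P k) 0) 0 (0 : 'M_(n + n))).
Proof.
move=> sP sS.
apply: pencil_cong_trans (dsum_block_cong (fun k => block_mx 0 (S k) (- S k) 0)
  (fun k => block_mx 0 (P k) (- P k) 0) (fun k => block_mx 0 (P k) (- P k) 0) (fun=> 0) K).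
apply: dsum_cong; last exact: pencil_cong_refl.
(* Reorders the four blocks of basis vectors as 2, 4, 1, 3; blocks 1 and 3 together are isotropic
   because the upper left corner of the off-diagonal matrix is zero. *)
pose X : 'M[R]_(n + n + (n + n)) := block_mx (block_mx 0 1%:M 0 0) (block_mx 0 0 0 1%:M)
   (block_mx 1%:M 0 0 0) (block_mx 0 0 1%:M 0).
have XX : X *m X^T = 1%:M.
  rewrite /X !tr_block_mx !trmx0 !trmx1 !mulmx_block.
  by rewrite ?(mulmx0, mul0mx, mulmx1, mul1mx, addr0, add0r, block_mx0, add_block_mx)
             -?scalar_mx_block.
exists X, X^T; split=> [//||k]; first exact: mulmx1C.
rewrite /X !tr_block_mx !trmx0 !trmx1 sP sS !opp_block_mx !mulmx_block.
by rewrite ?(mulmx_block, mulmx0, mul0mx, mulmx1, mul1mx, addr0, add0r, oppr0,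
            block_mx0, add_block_mx).
Qed.

Definition blk_pencil (s : elt R) (k : 'I_2) : 'M[R]_(blk_rows s + blk_cols s) :=
  blk_J s (if k == 0 then 1 else 0) (if k == 0 then 0 else 1).

Definition pencil (S : seq (elt R)) (k : 'I_2) : 'M[R]_(dim_n1 S) :=
  J_mx S (if k == 0 then 1 else 0) (if k == 0 then 0 else 1).

Lemma pencil_skew S k : (pencil S k)^T = - pencil S k.
Proof. exact: J_mx_skew. Qed.

Lemma pencil_cons s S : pencil (s :: S) =1 dsum (blk_pencil s) (pencil S).
Proof. by []. Qed.

Lemma pencil_extract S1 s S2 :
  pencil_cong (pencil (S1 ++ s :: S2)) (dsum (blk_pencil s) (pencil (S1 ++ S2))).
Proof.
elim: S1 => [|s' S1 IH] /=; first exact: pencil_cong_refl.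
apply: pencil_cong_trans (dsumCA_cong _ _ _).
exact: (dsum_cong (pencil_cong_refl (fun=> erefl)) IH).
Qed.

Definition blk_entry_mx (s : elt R) p q (k : 'I_2) : 'M[R]_(p, q) :=
  \matrix_(i, j) blk_entry s (if k == 0 then 1 else 0) (if k == 0 then 0 else 1) i j.

Lemma blk_pencil_cong s p q : blk_rows s = p -> blk_cols s = q ->
  pencil_cong (blk_pencil s)
    (fun k => block_mx 0 (blk_entry_mx s p q k) (- (blk_entry_mx s p q k)^T) 0).
Proof. by move=> <- <-; apply: pencil_cong_refl. Qed.

Lemma soliton_pencil_cong N M (J : 'I_2 -> 'M[R]_N) (K : 'I_2 -> 'M[R]_M) T h lam :
  pencil_cong J K -> soliton_eqs J T h lam 0 -> exists T', soliton_eqs K T' h lam 0.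
Proof.
move=> [P [Q [PQ QP KE]]] /(soliton_congr PQ QP KE)[T' [E' [E0 sol]]].
by exists T'; rewrite -(E0 erefl).
Qed.

Definition is_pair (s : elt R) : bool := if s is Pair _ _ then true else false.

(** At x = 0, y = 1 the value of the root disappears and real and nonreal blocks alike become the
    exchange matrix. In the nonreal case i + j + 1 = 2 k means that the 2 x 2 block is antidiagonal
    and the parities differ. *)
Lemma blk_entry_pair_exchange (al : R[i]) k i j : (i < blk_rows (Pair al k))%N ->
  blk_entry (Pair al k) 0 1 i j = ((i + j).+1 == blk_rows (Pair al k))%:R.
Proof.
case: al => a b /=; case: (b == 0) => ik.
  rewrite /real_entry; case: eqP => _; first by rewrite mulr0 subr0.
  by case: eqP.
rewrite /complex_entry !mulr0 !subr0 oppr0.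
have -> : (i + j).+1 == (2 * k)%N = ((i./2 + j./2).+1 == k) && (odd i != odd j).
  have := odd_double_half i; have := odd_double_half j.
  case: (odd i); case: (odd j) => /=; rewrite -!mul2n => jE iE; lia.
case: eqP => _ /=; first by case: (odd i); case: (odd j).
by case: eqP => //= _; case: (odd i == odd j).
Qed.

End Pencils.

(** * Regularity and simple roots of the pencils of the given blocks *)

Section Structure.
Variable R : realType.
Implicit Types (s : elt R) (S : seq (elt R)).

Lemma blk_pencil_unit s : is_pair s -> blk_pencil s 1 \in unitmx.
Proof.
case: s => [[a b] k|//] _; rewrite /blk_pencil /blk_J /=.
have Au : blk_A (Pair (a +i* b)%C k) 0 1 \in unitmx.
  have -> : blk_A (Pair (a +i* b)%C k) 0 1 = perm_mx (perm (@rev_ord_inj _));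
    last exact: unitmx_perm.
  apply/matrixP => i j; rewrite mxE blk_entry_pair_exchange // !mxE permE.
  congr (nat_of_bool _)%:R; apply/eqP/eqP => [ij|<-];
    last by rewrite /=; have := ltn_ord i; rewrite /=; lia.
  by apply: ord_inj; rewrite /=; move: ij (ltn_ord j) => /=; lia.
move: (blk_A _ _ _) Au => A Au.
rewrite -row_free_unit -kermx_eq0; apply/rowV0P => u /sub_kermxP.
rewrite -[u]hsubmxK mul_row_block !mulmx0 add0r addr0 => /eqP.
rewrite row_mx_eq0 mulmxN oppr_eq0 => /andP[/eqP u1 /eqP u2].
apply/eqP; rewrite row_mx_eq0 -(mulmxK Au (lsubmx u)) u2 mul0mx eqxx /=.
have Atu : A^T \in unitmx by rewrite unitmx_tr.
by rewrite -(mulmxK Atu (rsubmx u)) u1 mul0mx.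
Qed.

Lemma pencil_unit S : all (@is_pair R) S -> pencil S 1 \in unitmx.
Proof.
elim: S => [_|s S IH /andP[sp /IH Su]]; first by rewrite unitmxE det_mx00 unitr1.
by rewrite unitmxE pencil_cons det_ublock unitrM -!unitmxE blk_pencil_unit.
Qed.

Lemma unit_nondegenerate N (J : 'I_2 -> 'M[R]_N) : J 1 \in unitmx -> nondeg_pencil J.
Proof. by move=> Ju u /(_ 1) uJ; rewrite -(mulmxK Ju u) uJ mul0mx. Qed.

Lemma dsum_nondegenerate N M (J : 'I_2 -> 'M[R]_N) (K : 'I_2 -> 'M[R]_M) :
  nondeg_pencil J -> nondeg_pencil K -> nondeg_pencil (dsum J K).
Proof.
move=> ndJ ndK u uJK.
have uE k : lsubmx u *m J k = 0 /\ rsubmx u *m K k = 0.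
  move: (uJK k); rewrite -{1}[u]hsubmxK mul_row_block !mulmx0 addr0 add0r => /eqP.
  by rewrite row_mx_eq0 => /andP[/eqP ? /eqP].
rewrite -[u]hsubmxK (ndJ (lsubmx u)) => [|k]; last by have [] := uE k.
by rewrite (ndK (rsubmx u)) ?row_mx0 // => k; have [] := uE k.
Qed.

Lemma eps1_nondegenerate : nondeg_pencil (blk_pencil (Eps R 1)).
Proof.
move=> u uJ; have u0 := uJ 0; have u1 := uJ 1; move: u0 u1.
rewrite -[u]hsubmxK; move: (lsubmx u) (rsubmx u) => /= v w.
rewrite /blk_pencil /blk_J /= !mul_row_block !mulmx0 !addr0 !add0r.
move=> /eqP; rewrite row_mx_eq0 => /andP[/eqP w0 /eqP v0].
move=> /eqP; rewrite row_mx_eq0 => /andP[/eqP w1 /eqP v1].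
apply/eqP; rewrite row_mx_eq0; apply/andP; split; apply/eqP/rowP => i.
  move: v0 v1 => /rowP/(_ 0) + /rowP/(_ 0); rewrite !mxE !big_ord_recl !big_ord0 !mxE /=.
  rewrite /eps_entry /= => e0 e1; case: (ord2P i) => ->.
    have <- : ord0 = 0 :> 'I_2 by []. 
    lra.
  have -> : (1 : 'I_2) = lift ord0 ord0 by apply: val_inj.
  lra.
move: w1 => /rowP/(_ 0); rewrite !mxE !big_ord_recl !big_ord0 !mxE !ord1 /= /eps_entry /=; lra.
Qed.

Lemma pencil_nondegenerate S : (forall s, List.In s S -> is_pair s \/ s = Eps R 1) ->
  nondeg_pencil (pencil S).
Proof.
elim: S => [_ u _|s S IH SP]; first by apply/rowP => -[].
apply: dsum_nondegenerate; last by apply: IH => s' Ss'; apply: SP; right.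
have [sp|->] := SP s (or_introl erefl); last exact: eps1_nondegenerate.
exact/unit_nondegenerate/blk_pencil_unit.
Qed.

Lemma simple_root_cong N M (J : 'I_2 -> 'M[R]_N) (K : 'I_2 -> 'M[R]_M) tau :
  pencil_cong J K -> simple_root K tau -> simple_root J tau.
Proof.
move=> [P [Q [PQ QP KE]]] [X [Y [X' [Y' [[t0 X0 Y0] [X0' Y0'] req q0]]]]].
have eqJ c V W : V *m K 0 = c *: (W *m K 1) -> V *m P *m J 0 = c *: (W *m P *m J 1).
  rewrite !KE => /(congr1 (mulmx^~ Q^T)).
  have PQT A : A *m P^T *m Q^T = A by rewrite -mulmxA -trmx_mul QP trmx1 mulmx1.
  by rewrite -scalemxAl !mulmxA !PQT.
have fE A B : mxform (J 1) (A *m P) (B *m P) = mxform (K 1) A B.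
  by rewrite /mxform KE trmx_mul !mulmxA.
by exists (X *m P), (Y *m P), (X' *m P), (Y' *m P); rewrite !fE; split=> //; split=> //; apply: eqJ.
Qed.

Lemma simple_root_dsuml N M (J : 'I_2 -> 'M[R]_N) (K : 'I_2 -> 'M[R]_M) tau :
  simple_root J tau -> simple_root (dsum J K) tau.
Proof.
move=> [X [Y [X' [Y' [[t0 X0 Y0] [X0' Y0'] req q0]]]]].
have mE V k : row_mx V 0 *m dsum J K k = row_mx (V *m J k) 0.
  by rewrite mul_row_block !mulmx0 !mul0mx !addr0.
have fE A B : mxform (dsum J K 1) (row_mx A 0) (row_mx B 0) = mxform (J 1) A B.
  by rewrite /mxform mE tr_row_mx mul_row_col mul0mx addr0.
exists (row_mx X 0), (row_mx Y 0), (row_mx X' 0), (row_mx Y' 0).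
by rewrite !fE !mE !scale_row_mx !scaler0 X0 Y0 X0' Y0'.
Qed.

Lemma simple_root_pencil S1 s S2 tau :
  simple_root (blk_pencil s) tau -> simple_root (pencil (S1 ++ s :: S2)) tau.
Proof.
move=> root; apply: simple_root_cong (pencil_extract S1 s S2) _.
exact: simple_root_dsuml.
Qed.

(** The same complex vector, with real part [delta_mx 0 1] and imaginary part [delta_mx 0 0], is
    placed in each of the two halves of the block; J_1 pairs the halves with each other. *)
Lemma simple_root_blk (t : R) : t != 0 -> simple_root (blk_pencil (Pair (0 +i* t)%C 1)) t.
Proof.
move=> t0; pose s : elt R := Pair (0 +i* t)%C 1.
apply: (@simple_root_cong _ (2 + 2) _ _ _ (blk_pencil_cong (p := 2) (q := 2) _ _));
  rewrite /= ?(negPf t0) //.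
pose A := blk_entry_mx s 2 2.
pose v : 'rV[R]_2 := delta_mx 0 1; pose w : 'rV[R]_2 := delta_mx 0 0.
have AE : [/\ v *m A 0 = t *: (w *m A 1), w *m A 0 = - t *: (v *m A 1),
   v *m - (A 0)^T = t *: (w *m - (A 1)^T) & w *m - (A 0)^T = - t *: (v *m - (A 1)^T)].
  rewrite !mulmxN /v /w -!rowE; split; apply/rowP => i; rewrite !mxE /= (negPf t0) /complex_entry;
  by case: (ord2P i) => -> /=; ring.
have [A1 A2 A3 A4] := AE.
exists (row_mx v 0), (row_mx w 0), (row_mx 0 v), (row_mx 0 w).
rewrite /mxform !mul_row_block !tr_row_mx !mul_row_col !mulmx0 !mul0mx !trmx0 !mulmx0 !addr0 !add0r.
rewrite !scale_row_mx !scaler0 -/A A1 A2 A3 A4; split=> //.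
  rewrite /v /w -!rowE !trmx_delta -!colE !mxE /= (negPf t0) /complex_entry /=; ring.
rewrite /v /w -!rowE !trmx_delta -!colE !mxE /= (negPf t0) /complex_entry /=.
by rewrite !mul0r subr0 -mulr2n pnatr_eq0.
Qed.

End Structure.

(** * Nonexistence of nilsoliton metrics *)

Section NoNilsoliton.
Variable R : realType.

(** The shape of a Jordan block of size two: [P] is the pencil of the root itself, of size 1 if the
    root is real and 2 if not, and [S] is x times the y-coefficient of [P]. *)
Definition double_root (s : elt R) : Prop := exists n (P S : 'I_2 -> 'M[R]_n),
  [/\ (0 < n)%N, forall k, (P k)^T = P k, P 1 \in unitmx, S 0 = P 1 /\ S 1 = 0 &
    pencil_cong (blk_pencil s)
      (fun k => block_mx 0 (block_mx 0 (P k) (P k) (S k))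
                         (- (block_mx 0 (P k) (P k) (S k))^T) 0)].

Lemma blk_entry_mx_real2 k : blk_entry_mx (Pair 0 2) (1 + 1) (1 + 1) k =
  block_mx 0 (if k == 0 then 0 else 1%:M) (if k == 0 then 0 else 1%:M)
             (if k == 0 then 1%:M else 0) :> 'M[R]_(1 + 1).
Proof.
apply/matrixP => i j; rewrite mxE /= eqxx.
by case: (split_ordP i) => i' ->; case: (split_ordP j) => j' ->;
   rewrite ?block_mxEul ?block_mxEur ?block_mxEdl ?block_mxEdr !ord1 /=;
   case: (ord2P k) => -> /=; rewrite !mxE /real_entry //= ?mul0r ?subr0.
Qed.

Lemma blk_entry_mx_complex2 (t : R) k : t != 0 ->
  blk_entry_mx (Pair (0 +i* t)%C 2) (2 + 2) (2 + 2) k =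
  block_mx 0 (blk_entry_mx (Pair (0 +i* t)%C 1) 2 2 k) (blk_entry_mx (Pair (0 +i* t)%C 1) 2 2 k)
             (if k == 0 then blk_entry_mx (Pair (0 +i* t)%C 1) 2 2 1 else 0).
Proof.
move=> t0; apply/matrixP => i j; rewrite mxE /= (negPf t0).
case: (split_ordP i) => i' ->; case: (split_ordP j) => j' ->;
   rewrite ?block_mxEul ?block_mxEur ?block_mxEdl ?block_mxEdr;
   case: (ord2P k) => -> /=; rewrite !mxE /= ?(negPf t0) /complex_entry;
   by case: (ord2P i') => ->; case: (ord2P j') => -> /=; ring.
Qed.

Lemma double_root_real : double_root (Pair 0 2).
Proof.
exists 1%N, (fun k => if k == 0 then 0 else 1%:M), (fun k => if k == 0 then 1%:M else 0).
split=> //; first by move=> k; case: (ord2P k) => -> /=; rewrite ?trmx0 ?trmx1.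
  exact: unitmx1.
apply: pencil_cong_trans (blk_pencil_cong (p := 1 + 1) (q := 1 + 1) _ _) _;
  rewrite /= ?eqxx //.
by apply: pencil_cong_refl => k; rewrite blk_entry_mx_real2.
Qed.

Lemma double_root_complex (t : R) : t != 0 -> double_root (Pair (0 +i* t)%C 2).
Proof.
move=> t0; pose P : 'I_2 -> 'M[R]_2 := blk_entry_mx (Pair (0 +i* t)%C 1) 2 2.
exists 2, P, (fun k => if k == 0 then P 1 else 0); split=> //.
- move=> k; apply/matrixP => i j; rewrite !mxE /= (negPf t0) /complex_entry.
  by case: (ord2P i) => ->; case: (ord2P j) => ->.
- have PP : P 1 *m P 1 = 1%:M.
    apply/matrixP => i j; rewrite !mxE sum2 !mxE /= (negPf t0) /complex_entry.
    by case: (ord2P i) => ->; case: (ord2P j) => -> /=; ring.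
  by case/mulmx1_unit: PP.
apply: pencil_cong_trans (blk_pencil_cong (p := 2 + 2) (q := 2 + 2) _ _) _;
  rewrite /= ?(negPf t0) //.
by apply: pencil_cong_refl => k; rewrite blk_entry_mx_complex2.
Qed.

Lemma double_root_not_einstein S1 s S2 T h lam : double_root s ->
  all (@is_pair R) (S1 ++ s :: S2) -> ~ soliton_eqs (pencil (S1 ++ s :: S2)) T h lam 0.
Proof.
move=> [n [P [S [n0 sP Pu [S0 S1'] sc]]]] allp sol.
have sS k : (S k)^T = S k.
  by case: (ord2P k) => ->; rewrite ?S0 ?S1' ?trmx0.
have cong := pencil_cong_trans (pencil_extract S1 s S2)
  (pencil_cong_trans (dsum_cong sc (pencil_cong_refl (fun=> erefl)))
     (dsum_antidiag_cong (pencil (S1 ++ S2)) sP sS)).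
have [T'] := soliton_pencil_cong cong sol; apply: jordan_not_einstein.
- by rewrite addn_gt0 n0.
- by move=> k; rewrite tr_block_mx opp_block_mx !linearN /= sS !trmx0 !oppr0 opprK.
- by move=> k; rewrite tr_block_mx opp_block_mx !linearN /= sP !trmx0 !oppr0 opprK.
- by move=> k; apply: pencil_skew.
- rewrite -row_free_unit -kermx_eq0; apply/rowV0P => u /sub_kermxP.
  rewrite -[u]hsubmxK mul_row_block !mulmx0 add0r addr0 => /eqP.
  rewrite row_mx_eq0 mulmxN oppr_eq0 => /andP[/eqP u1 /eqP u2].
  by rewrite -(mulmxK Pu (lsubmx u)) -(mulmxK Pu (rsubmx u)) u1 u2 !mul0mx row_mx0.
- by rewrite S0.
- by rewrite S1' oppr0 block_mx0.
Qed.

(** The sum [k + 1] is taken in ['I_2], hence modulo 2: x, with index 0, stands in the second row of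
    the block and y in the first. *)
Lemma eps1_cong N (K : 'I_2 -> 'M[R]_N) :
  pencil_cong (dsum (blk_pencil (Eps R 1)) K)
    (heis_sum K (fun k => - delta_mx 0 (k + 1))).
Proof.
set b := (fun k => _).
have := @dsum_block_cong R 1 2 N (fun=> 0) b (fun k => - (b k)^T) (fun=> 0) K.
apply: pencil_cong_trans; apply: dsum_cong; last exact: pencil_cong_refl.
pose X : 'M[R]_(1 + 2, 2 + 1) := block_mx 0 1%:M 1%:M 0.
pose Y : 'M[R]_(2 + 1, 1 + 2) := block_mx 0 1%:M 1%:M 0.
exists X, Y; split=> [||k].
- by rewrite mulmx_block !mulmx0 !mulmx1 !addr0 !add0r -scalar_mx_block.
- by rewrite mulmx_block !mulmx0 !mulmx1 !addr0 !add0r -scalar_mx_block.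
rewrite /X /blk_pencil /blk_J tr_block_mx !trmx0 !trmx1 !mulmx_block.
rewrite ?(mulmx0, mul0mx, mulmx1, mul1mx, addr0, add0r).
have bE : b k = - (blk_A (Eps R 1) (if k == 0 then 1 else 0) (if k == 0 then 0 else 1))^T.
  apply/matrixP => i j; rewrite !ord1 !mxE /= /eps_entry.
  by case: (ord2P k) => ->; case: (ord2P j) => -> /=.
by rewrite bE linearN /= trmxK opprK.
Qed.

Lemma pencil_no_nilsoliton S1 s S2 tau : double_root s ->
  all (@is_pair R) (S1 ++ s :: S2) -> simple_root (pencil (S1 ++ s :: S2)) tau ->
  ~ exists ip, nilsoliton (@br_S R (S1 ++ s :: S2)) ip.
Proof.
move=> dr allp root sol.
have [T [h [lam [E eqs]]]] := nilsoliton_eqs (@pencil_skew R _) root sol.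
have E0 := soliton_regular (pencil_unit allp) eqs.
by apply: double_root_not_einstein dr allp _; rewrite -E0; apply: eqs.
Qed.

Lemma pencil_eps_no_nilsoliton S1 s S2 tau : double_root s ->
  all (@is_pair R) (S1 ++ s :: S2) ->
  simple_root (pencil ((S1 ++ s :: S2) ++ [:: Eps R 1])) tau ->
  ~ exists ip, nilsoliton (@br_S R ((S1 ++ s :: S2) ++ [:: Eps R 1])) ip.
Proof.
move=> dr allp root sol.
have [T [h [lam [E eqs]]]] := nilsoliton_eqs (@pencil_skew R _) root sol.
have [P [Q [PQ QP KE]]] : pencil_cong (pencil ((S1 ++ s :: S2) ++ [:: Eps R 1]))
    (heis_sum (pencil (S1 ++ s :: S2)) (fun k => - delta_mx 0 (k + 1))).
  apply: pencil_cong_trans (pencil_extract _ _ _) _; rewrite cats0; exact: eps1_cong.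
have [T' [E' [_ eqs']]] := soliton_congr PQ QP KE eqs.
have [] := heis_sum_soliton (@pencil_skew R _) (pencil_unit allp) _ _ eqs'.
- by congr (- delta_mx _ _); apply: val_inj.
- by congr (- delta_mx _ _); apply: val_inj.
by move=> T'' [lam' eqs'']; apply: double_root_not_einstein dr allp eqs''.
Qed.

End NoNilsoliton.

(** * Rank of the complexified pencil *)

Section ComplexRank.
Variable R : realType.
Local Notation C := (R[i]).
Implicit Types (s : elt R) (S : seq (elt R)) (z w : 'I_2 -> C).

Definition cmx n m (A : 'M[R]_(n, m)) : 'M[C]_(n, m) := map_mx (real_complex R) A.

Definition cpencil n m (J : 'I_2 -> 'M[R]_(n, m)) z : 'M[C]_(n, m) :=
  \sum_k z k *: cmx (J k).

Lemma eq_cpencil n m (J K : 'I_2 -> 'M[R]_(n, m)) z : J =1 K -> cpencil J z = cpencil K z.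
Proof. by move=> JK; apply: eq_bigr => k _; rewrite JK. Qed.

Lemma cpencil_block n1 n2 m1 m2 (A : 'I_2 -> 'M[R]_(n1, m1)) B D (E : 'I_2 -> 'M[R]_(n2, m2)) z :
  cpencil (fun k => block_mx (A k) (B k) (D k) (E k)) z =
  block_mx (cpencil A z) (cpencil B z) (cpencil D z) (cpencil E z).
Proof.
by rewrite /cpencil !sum2 /cmx !map_block_mx !scale_block_mx add_block_mx.
Qed.

Lemma cpencil0 n m z : cpencil (fun=> 0 : 'M[R]_(n, m)) z = 0.
Proof. by rewrite /cpencil big1 // => k _; rewrite /cmx map_mx0 scaler0. Qed.

Lemma cpencilNtr n m (A : 'I_2 -> 'M[R]_(n, m)) z :
  cpencil (fun k => - (A k)^T) z = - (cpencil A z)^T.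
Proof.
rewrite /cpencil linear_sum -sumrN; apply: eq_bigr => k _.
by rewrite /cmx linearZ /= map_mxN map_trmx scalerN.
Qed.

Definition cact (g : 'M[R]_2) w (k : 'I_2) : C := \sum_l (real_complex R (g k l)) * w l.

(** By linearity, the pencil [J] at the point [g w] is P K(w) P^T. *)
Lemma cpencil_pull N M (J : 'I_2 -> 'M[R]_N) (K : 'I_2 -> 'M[R]_M) (P : 'M_(N, M)) (g : 'M_2) w :
  (forall l, P *m K l *m P^T = \sum_k g k l *: J k) ->
  (\rank (cpencil J (cact g w)) <= \rank (cpencil K w))%N.
Proof.
move=> PKP.
have -> : cpencil J (cact g w) = cmx P *m cpencil K w *m (cmx P)^T.
  rewrite /cpencil /cact mulmx_sumr mulmx_suml.
  transitivity (\sum_l w l *: cmx (P *m K l *m P^T)); last first.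
    apply: eq_bigr => l _; rewrite -scalemxAr -scalemxAl; congr (_ *: _).
    by rewrite /cmx !map_mxM map_trmx.
  under eq_bigr => k _ do rewrite scaler_suml.
  rewrite exchange_big; apply: eq_bigr => l _ /=; rewrite PKP /cmx.
  rewrite (raddf_sum (map_mx (real_complex R))) scaler_sumr; apply: eq_bigr => k _ /=.
  by rewrite map_mxZ scalerA mulrC.
by rewrite (leq_trans (mxrankM_maxl _ _)) ?mxrankM_maxr.
Qed.

Lemma cpencil_cong N M (J : 'I_2 -> 'M[R]_N) (K : 'I_2 -> 'M[R]_M) z :
  pencil_cong J K -> \rank (cpencil J z) = \rank (cpencil K z).
Proof.
suff le N' M' (J' : 'I_2 -> 'M[R]_N') (K' : 'I_2 -> 'M[R]_M') : pencil_cong J' K' ->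
    (\rank (cpencil K' z) <= \rank (cpencil J' z))%N.
  by move=> JK; apply/eqP; rewrite eqn_leq !le //; apply: pencil_cong_sym.
move=> [P [Q [PQ QP KE]]].
have := @cpencil_pull _ _ K' J' P 1%:M z; set z' := cact _ _.
have -> : cpencil K' z' = cpencil K' z.
  apply: eq_bigr => k _; congr (_ *: _); rewrite /z' /cact (bigD1 k) //=.
  rewrite big1 ?addr0 => [|l /negPf lk].
    by rewrite mxE eqxx mul1r.
  by rewrite mxE eq_sym lk mul0r.
apply=> l; rewrite -KE (bigD1 l) //= big1 ?addr0 => [|k /negPf kl]; rewrite mxE ?eqxx ?scale1r //.
by rewrite kl scale0r.
Qed.

Lemma rank_cpencil_antidiag n m (A : 'I_2 -> 'M[R]_(n, m)) z :
  \rank (cpencil (fun k => block_mx 0 (A k) (- (A k)^T) 0) z) = (\rank (cpencil A z)).*2.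
Proof.
rewrite (cpencil_block (fun=> 0) A (fun k => - (A k)^T) (fun=> 0)) !cpencil0 cpencilNtr.
set B := cpencil A z.
have U : row_free (block_mx 0 1%:M 1%:M 0 : 'M[C]_(n + m, m + n)).
  apply/row_freeP; exists (block_mx 0 1%:M 1%:M 0).
  by rewrite mulmx_block !mulmx0 !mulmx1 !addr0 !add0r -scalar_mx_block.
rewrite -(mxrankMfree _ U) mulmx_block !mulmx0 !mulmx1 ?mul0mx !addr0 !add0r.
by rewrite rank_diag_block_mx mxrank_opp mxrank_tr addnn.
Qed.

(** The rank at a generic point; an [Eps e] block has size 2 e + 1 but rank at most 2 e. *)
Definition gen_rank s : nat :=
  if s is Eps e then e.*2 else (blk_rows s + blk_cols s)%N.

Lemma blk_rank_le s z : (\rank (cpencil (blk_pencil s) z) <= gen_rank s)%N.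
Proof.
case: s => [al k|e]; first exact: rank_leq_row.
rewrite (cpencil_cong _ (blk_pencil_cong (p := e.+1) (q := e) _ _)) //.
by rewrite rank_cpencil_antidiag leq_double rank_leq_col.
Qed.

Definition sing z s := (\rank (cpencil (blk_pencil s) z) < gen_rank s)%N.

(** Each summand is bounded by its own generic rank, so the total drops exactly when some summand
    does; the bound is carried along in the induction. *)
Lemma pencil_rank z S :
  (\rank (cpencil (pencil S) z) < \sum_(s <- S) gen_rank s)%N = has (sing z) S.
Proof.
suff [] : ((\rank (cpencil (pencil S) z) <= \sum_(s <- S) gen_rank s)%N /\
   (\rank (cpencil (pencil S) z) < \sum_(s <- S) gen_rank s)%N = has (sing z) S) by [].
elim: S => [|s S [IHle IHlt]].
  by rewrite big_nil; split; [exact: rank_leq_row|rewrite ltn0].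
rewrite big_cons (eq_cpencil z (pencil_cons s S)) cpencil_block !cpencil0 rank_diag_block_mx.
have sle := blk_rank_le s z; rewrite /= -IHlt /sing; split; first exact: leq_add.
move: sle IHle; move: (\rank _) (\rank _) (gen_rank s) (\sum_(s <- S) gen_rank s)%N.
by clear; move=> a b c d ac bd; lia.
Qed.

Lemma sing_pair s n z : is_pair s -> blk_rows s = n -> blk_cols s = n ->
  sing z s = (\det (cpencil (blk_entry_mx s n n) z) == 0).
Proof.
move=> sp rn cn; rewrite /sing (cpencil_cong _ (blk_pencil_cong rn cn)).
rewrite rank_cpencil_antidiag -addnn.
have -> : gen_rank s = (n + n)%N by case: s sp rn cn => // -[a b] k _ /= -> _.
set A := cpencil _ z; rewrite -[RHS]negbK -unitfE -unitmxE -row_free_unit /row_free.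
by have := rank_leq_row A; lia.
Qed.

Lemma det2 (K : comNzRingType) (A : 'M[K]_2) : \det A = A 0 0 * A 1 1 - A 0 1 * A 1 0.
Proof.
rewrite (expand_det_row _ 0) sum2 /cofactor !det_mx11 !mxE /= expr0 expr1 mul1r mulN1r mulrN.
congr (_ * A _ _ - _ * A _ _); apply: val_inj => //=.
Qed.

(** Exchanging the block columns gives a block triangular matrix with [P] twice on the diagonal: a
    double root is singular at the same points as the simple one. *)
Lemma det_antitriangular n (P S : 'M[C]_n) : (\det (block_mx 0 P P S) == 0) = (\det P == 0).
Proof.
pose X : 'M[C]_(n + n) := block_mx 0 1%:M 1%:M 0.
have XX : X *m X = 1%:M.
  by rewrite mulmx_block !mulmx0 !mulmx1 !addr0 !add0r -scalar_mx_block.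
have Xu : \det X != 0 by rewrite -unitfE -unitmxE; case/mulmx1_unit: XX.
rewrite -[LHS]orbF -(negPf Xu) -mulf_eq0 -det_mulmx mulmx_block.
rewrite !mulmx0 !mulmx1 ?mul0mx !addr0 !add0r det_lblock.
by rewrite mulf_eq0 orbb.
Qed.

End ComplexRank.

(** * Singular points of each kind of block *)

Section SingularPoints.
Variable R : realType.
Local Notation C := (R[i]).
Implicit Types (z w : 'I_2 -> C).

Lemma cpencil_entry n m (J : 'I_2 -> 'M[R]_(n, m)) z i j :
  cpencil J z i j = z 0 * real_complex R (J 0 i j) + z 1 * real_complex R (J 1 i j).
Proof. by rewrite /cpencil sum2 !mxE. Qed.

Let isz (t : R) z := z 1 ^+ 2 + (real_complex R t * z 0) ^+ 2 == 0.

Lemma det_complex1 (t : R) z : t != 0 ->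
  (\det (cpencil (blk_entry_mx (Pair (0 +i* t)%C 1) 2 2) z) == 0) = isz t z.
Proof.
move=> t0; rewrite det2 !cpencil_entry !mxE /= (negPf t0) /complex_entry /=.
rewrite ?(mulr1, mulr0, mul0r, oppr0, subr0) ?(rmorph0, rmorph1, rmorphN).
by rewrite /isz -oppr_eq0; congr (_ == 0); ring.
Qed.

Lemma sing_complex1 t z : t != 0 -> sing z (Pair (0 +i* t)%C 1) = isz t z.
Proof.
by move=> t0; rewrite (@sing_pair _ _ 2) ?det_complex1 //= (negPf t0).
Qed.

Lemma sing_complex2 t z : t != 0 -> sing z (Pair (0 +i* t)%C 2) = isz t z.
Proof.
move=> t0; rewrite (@sing_pair _ _ (2 + 2)) /= ?(negPf t0) //.
rewrite (eq_cpencil z (fun k => blk_entry_mx_complex2 k t0)).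
by rewrite cpencil_block cpencil0 det_antitriangular det_complex1.
Qed.

Lemma sing_real2 z : sing z (Pair 0 2) = (z 1 == 0).
Proof.
rewrite (@sing_pair _ _ (1 + 1)) /= ?eqxx // (eq_cpencil z (@blk_entry_mx_real2 R)).
rewrite (cpencil_block (fun=> 0) (fun k => if k == 0 then 0 else 1%:M)
  (fun k => if k == 0 then 0 else 1%:M) (fun k => if k == 0 then 1%:M else 0)).
rewrite cpencil0 det_antitriangular det_mx11 cpencil_entry /= !mxE /=.
by rewrite rmorph0 rmorph1 mulr0 mulr1 add0r.
Qed.

Lemma sing_real1 (a : R) z : sing z (Pair (a +i* 0)%C 1) = (z 1 == real_complex R a * z 0).
Proof.
rewrite (@sing_pair _ _ 1) /= ?eqxx // det_mx11 cpencil_entry !mxE /= eqxx /real_entry /=.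
rewrite mulr1 mulr0 subr0 sub0r rmorphN rmorph1 mulr1 -[RHS]subr_eq0; congr (_ == 0); ring.
Qed.

(** This block drops rank only at the origin; the conclusion has the form shared with the block of
    root 0. *)
Lemma sing_eps1 z : sing z (Eps R 1) -> z 1 = 0.
Proof.
rewrite /sing (cpencil_cong _ (blk_pencil_cong (p := 2) (q := 1) _ _)) //.
rewrite rank_cpencil_antidiag ltn_double ltnS leqn0 mxrank_eq0 => /eqP/matrixP/(_ 0 0).
rewrite cpencil_entry !mxE /= /eps_entry /= rmorph0 rmorph1 mulr0 mulr1 add0r.
by [].
Qed.

Lemma cact_complex (g : 'M[R]_2) (t : R) k :
  cact g (fun l => if l == 0 then 1 else (0 +i* t)%C) k = (g k 0 +i* (t * g k 1))%C.
Proof.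
rewrite /cact sum2 /= mulr1; simpc; by rewrite mulrC.
Qed.

Lemma cact_real (g : 'M[R]_2) (a : R) k :
  cact g (fun l => if l == 0 then 1 else real_complex R a) k = real_complex R (g k 0 + a * g k 1).
Proof.
by rewrite /cact sum2 /= mulr1 rmorphD rmorphM mulrC.
Qed.

Lemma isz_complex (t a b c d : R) : t != 0 ->
  (c +i* d)%C ^+ 2 + (real_complex R t * (a +i* b)%C) ^+ 2 == 0 ->
  (c = - (t * b) /\ d = t * a) \/ (c = t * b /\ d = - (t * a)).
Proof.
move=> t0; set u := (c +i* d)%C; set v := _ * _.
have ii : 'i%C * 'i%C = - 1 :> C by simpc.
have -> : u ^+ 2 + v ^+ 2 = (u - 'i%C * v) * (u + 'i%C * v).
  transitivity (u ^+ 2 - ('i%C * 'i%C) * v ^+ 2); last by ring.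
  by rewrite ii; ring.
rewrite mulf_eq0 /u /v; simpc; rewrite !eq_complex /= => /orP[]/andP[/eqP h1 /eqP h2].
  by left; split; lra.
by right; split; lra.
Qed.

End SingularPoints.

(** * Isomorphisms within a family determine the parameter *)

Section Families.
Variable R : realType.
Implicit Types (s : elt R) (S E : seq (elt R)).

Lemma all_In (T : Type) (p : pred T) (S : seq T) x : all p S -> List.In x S -> p x.
Proof. by elim: S => // y S IH /= /andP[py /IH pS] [<-|]. Qed.

Definition nonsoliton_algebra m S : Prop :=
  nondeg_pencil (pencil S) /\
  [/\ of_type 2 m (@mu_S R S),
      lie_bracket (@br_S R S) /\ two_step_nilpotent (@br_S R S),
      indecomposable (@br_S R S) &
      ~ exists ip, nilsoliton (@br_S R S) ip].

Lemma double_root_nonsoliton m S1 s S2 (eps : bool) tau :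
  let S := (S1 ++ s :: S2) ++ nseq eps (Eps R 1) in
  double_root s -> all (@is_pair R) (S1 ++ s :: S2) -> simple_root (pencil S) tau ->
  dim_n1 S = m -> nonsoliton_algebra m S.
Proof.
move=> S dr allp root <-.
have ndg : nondeg_pencil (pencil S).
  apply: pencil_nondegenerate => x /(@List.in_app_or _ _ _ _)[/(all_In allp)|]; first by left.
  by case: (eps) => //= -[<-|//]; right.
split=> //; split.
- by have := mu_of_type (@pencil_skew R S) root.
- split; first by have := bracket_of_lie (@pencil_skew R S).
  by have := bracket_of_two_step root.
- by have := bracket_of_indecomposable (@pencil_skew R S) root ndg.
move: @S root {ndg}; case: eps => /= root.
  exact: pencil_eps_no_nilsoliton dr allp root.
by rewrite cats0 in root *; apply: pencil_no_nilsoliton dr allp root.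
Qed.

(** With equal generic ranks, the rank inequality of the pulled back pencil transports singular
    points. *)
Lemma isomorphic_sing S S' : nondeg_pencil (pencil S') ->
  (\sum_(s <- S) gen_rank s = \sum_(s <- S') gen_rank s)%N ->
  lie_isomorphic (@br_S R S) (@br_S R S') ->
  exists2 g : 'M[R]_2, g 0 0 * g 1 1 - g 0 1 * g 1 0 != 0 &
    forall w, has (sing w) S' -> has (sing (cact g w)) S.
Proof.
move=> ndg eqS iso.
have [P [g [gu Pg]]] := isomorphic_congr (@pencil_skew R _) ndg iso.
exists g; first by rewrite -det2 -unitfE -unitmxE.
move=> w; rewrite -!pencil_rank eqS; apply: leq_ltn_trans; exact: cpencil_pull.
Qed.

Lemma eq_of_multiple (s t a : R) : 1 < s -> 1 < t -> a != 0 ->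
  t * a = s * a \/ t * a = - (s * a) -> s = t.
Proof.
move=> s1 t1 a0 [/(mulIf a0)//|]; rewrite -mulNr => /(mulIf a0); lra.
Qed.

(** The hypotheses locate the images of (1, 0), (1, 1) and (1, it). If both real points went to the
    same line, [g] would be singular; otherwise d = a or d = - a, and the nonreal point gives t = s
    up to sign. *)
Lemma real_points_iso (s t : R) (g : 'M[R]_2) : 1 < s -> 1 < t ->
  g 0 0 * g 1 1 - g 0 1 * g 1 0 != 0 ->
  (g 1 0 = 0 \/ g 1 0 = g 0 0) ->
  (g 1 0 + g 1 1 = 0 \/ g 1 0 + g 1 1 = g 0 0 + g 0 1) ->
  (g 1 0 = - (s * (t * g 0 1)) /\ t * g 1 1 = s * g 0 0) \/
  (g 1 0 = s * (t * g 0 1) /\ t * g 1 1 = - (s * g 0 0)) -> s = t.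
Proof.
move: (g 0 0) (g 0 1) (g 1 0) (g 1 1) => a b c d s1 t1 det.
have st0 : s * t != 0 by rewrite mulf_neq0 // gt_eqF // (lt_trans ltr01).
case=> [c0|ca] [cd|cd] h.
- have d0 : d = 0 by move: cd; rewrite c0 add0r.
  by rewrite c0 d0 !mulr0 subrr eqxx in det.
- have b0 : b = 0.
    apply: (mulfI st0); rewrite mulr0 -mulrA.
    by case: h => -[] /eqP; rewrite c0 1?eq_sym ?oppr_eq0 => /eqP.
  have da : d = a by move: cd; rewrite c0 b0 add0r addr0.
  move: det h; rewrite c0 b0 da mulr0 subr0 mulf_eq0 orbb => a0 h.
  by apply: (eq_of_multiple s1 t1 a0); case: h => -[_]; [left|right].
- have da : d = - a by move: cd; rewrite ca; lra.
  have a0 : a != 0 by apply: contra det => /eqP a0; rewrite ca a0 mul0r mulr0 subrr.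
  apply: (eq_of_multiple s1 t1 a0); move: h; rewrite da mulrN.
  by case=> -[_] h; [right|left]; lra.
- have db : d = b by move: cd; rewrite ca; lra.
  by rewrite ca db mulrC subrr eqxx in det.
Qed.

(** The points (1, it) and (1, i) go to roots +- i x and +- i y with x, y in {s, 1}. Squaring
    removes the signs: t y = x if b = 0, and x t = y otherwise. As s and t exceed 1, x and y are 1
    and s in the order that yields s = t. *)
Lemma complex_points_iso (s t : R) (g : 'M[R]_2) : 1 < s -> 1 < t ->
  g 0 0 * g 1 1 - g 0 1 * g 1 0 != 0 ->
  (exists2 x, x = s \/ x = 1 &
    (g 1 0 = - (x * (t * g 0 1)) /\ t * g 1 1 = x * g 0 0) \/
    (g 1 0 = x * (t * g 0 1) /\ t * g 1 1 = - (x * g 0 0))) ->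
  (exists2 x, x = s \/ x = 1 &
    (g 1 0 = - (x * (1 * g 0 1)) /\ 1 * g 1 1 = x * g 0 0) \/
    (g 1 0 = x * (1 * g 0 1) /\ 1 * g 1 1 = - (x * g 0 0))) -> s = t.
Proof.
move: (g 0 0) (g 0 1) (g 1 0) (g 1 1) => a b c d s1 t1 det [x xs h] [y ys k].
have [h1 h2] : c ^+ 2 = (x * t) ^+ 2 * b ^+ 2 /\ (t * d) ^+ 2 = x ^+ 2 * a ^+ 2.
  by case: h => -[-> ->]; split; ring.
have [k1 k2] : c ^+ 2 = y ^+ 2 * b ^+ 2 /\ d ^+ 2 = y ^+ 2 * a ^+ 2.
  by case: k => -[-> ]; rewrite mul1r => ->; split; ring.
have x0 : 0 < x by case: xs => ->; lra.
have y0 : 0 < y by case: ys => ->; lra.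
have [b0|b0] := eqVneq b 0.
  have a0 : a != 0.
    apply: contra det => /eqP a0.
    by rewrite a0 b0 !mul0r subrr.
  have /eqP : (t * y) ^+ 2 = x ^+ 2.
    by apply: (mulIf (expf_neq0 2 a0)); rewrite -h2 exprMn -mulrA -k2 exprMn.
  rewrite eqrXn2 ?ltW ?mulr_gt0 //; last by lra.
  by case: xs ys => -> [] -> /eqP; nra.
have /eqP : (x * t) ^+ 2 = y ^+ 2.
  by apply: (mulIf (expf_neq0 2 b0)); rewrite -h1.
rewrite eqrXn2 ?ltW ?mulr_gt0 //; last by lra.
by case: xs ys => -> [] -> /eqP; nra.
Qed.

Lemma complex_point_root (x : R) :
  (0 +i* x)%C ^+ 2 + (real_complex R x * 1) ^+ 2 == 0.
Proof. by rewrite mulr1 !expr2; simpc; rewrite addNr eq_complex /= eqxx. Qed.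

Lemma nonreal_point (t a b c d : R) : t != 0 -> a * d - b * c != 0 ->
  (c +i* (t * d))%C != 0 /\ (c +i* (t * d))%C != (a +i* (t * b))%C.
Proof.
move=> t0 det; rewrite !eq_complex /=; split; apply: contra det => /andP[/eqP h1 /eqP].
  by move/eqP; rewrite mulf_eq0 (negPf t0) => /eqP ->; rewrite h1 !mulr0 subrr.
by move/(mulfI t0) ->; rewrite h1 mulrC subrr.
Qed.

Definition real_family r E (t : R) :=
  ([:: Pair (0 +i* t)%C 1; Pair 0 2] ++ nseq r (Pair 1 1)) ++ E.
Definition imag_family r E (t : R) :=
  ([:: Pair (0 +i* t)%C 2] ++ nseq r (Pair (0 +i* 1)%C 1)) ++ E.

Lemma real_family_iso r E (s t : R) : (0 < r)%N -> 1 < s -> 1 < t ->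
  (forall z, has (sing z) E -> z 1 = 0) ->
  nondeg_pencil (pencil (real_family r E t)) ->
  lie_isomorphic (@br_S R (real_family r E s)) (@br_S R (real_family r E t)) -> s = t.
Proof.
move=> r0 s1 t1 hE ndg.
have s0 : s != 0 by rewrite gt_eqF // (lt_trans ltr01).
have t0 : t != 0 by rewrite gt_eqF // (lt_trans ltr01).
case/(isomorphic_sing ndg).
  by rewrite /real_family !big_cons /= (negPf s0) (negPf t0).
move=> g det gsing.
have singA z : has (sing z) (real_family r E s) ->
    [\/ z 1 ^+ 2 + (real_complex R s * z 0) ^+ 2 == 0, z 1 = 0 | z 1 = z 0].
  rewrite /real_family has_cat /= has_nseq r0 sing_complex1 // sing_real2.
  rewrite (sing_real1 1) rmorph1 mul1r.
  case/orP=> [/or3P[|/eqP|/eqP]|/hE]; by [constructor 1|constructor 2|constructor 3|constructor 2].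
apply: (real_points_iso s1 t1 det).
- have /gsing/singA : has (sing (fun l => if l == 0 then 1 else real_complex R 0))
      (real_family r E t).
    by rewrite /real_family /= sing_real2 /= rmorph0 eqxx orbT.
  rewrite !cact_real !mul0r !addr0 => -[/(isz_complex s0)|/complexI|/complexI]; [|by left|by right].
  (* A real point annihilated by z_1^2 + s^2 z_0^2 has z_1 = 0, so this case falls under the first
     alternative. *)
  by case=> -[->] _; left; rewrite ?mulr0 ?oppr0.
- have /gsing/singA : has (sing (fun l => if l == 0 then 1 else real_complex R 1))
      (real_family r E t).
    rewrite /real_family has_cat /= has_nseq r0 (sing_real1 1) /= rmorph1 mul1r eqxx.
    by rewrite !orbT.
  rewrite !cact_real !mul1r => -[/(isz_complex s0)|/complexI|/complexI]; [|by left|by right].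
  by case=> -[->] _; left; rewrite ?mulr0 ?oppr0.
have /gsing/singA : has (sing (fun l => if l == 0 then 1 else (0 +i* t)%C)) (real_family r E t).
  by rewrite /real_family /= sing_complex1 //= complex_point_root.
rewrite !cact_complex; have [n1 n2] := nonreal_point t0 det.
by case=> [/(isz_complex s0)//|/eqP|/eqP]; rewrite ?(negPf n1) ?(negPf n2).
Qed.

Lemma imag_family_iso r E (s t : R) : (0 < r)%N -> 1 < s -> 1 < t ->
  (forall z, has (sing z) E -> z 1 = 0) ->
  nondeg_pencil (pencil (imag_family r E t)) ->
  lie_isomorphic (@br_S R (imag_family r E s))
    (@br_S R (imag_family r E t)) -> s = t.
Proof.
move=> r0 s1 t1 hE ndg.
have s0 : s != 0 by rewrite gt_eqF // (lt_trans ltr01).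
have t0 : t != 0 by rewrite gt_eqF // (lt_trans ltr01).
have o0 : 1 != 0 :> R := oner_neq0 R.
case/(isomorphic_sing ndg).
  by rewrite /imag_family !big_cons /= (negPf s0) (negPf t0).
move=> g det gsing.
have singB z : has (sing z) (imag_family r E s) ->
    [\/ z 1 ^+ 2 + (real_complex R s * z 0) ^+ 2 == 0,
        z 1 ^+ 2 + (real_complex R 1 * z 0) ^+ 2 == 0 | z 1 = 0].
  rewrite /imag_family has_cat /= has_nseq r0 sing_complex2 // sing_complex1 //.
  case/orP=> [/orP[]|/hE]; by [constructor 1|constructor 2|constructor 3].
have pt x : x != 0 ->
  has (sing (fun l => if l == 0 then 1 else (0 +i* x)%C)) (imag_family r E t) ->
  exists2 y, y = s \/ y = 1 &
    (g 1 0 = - (y * (x * g 0 1)) /\ x * g 1 1 = y * g 0 0) \/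
    (g 1 0 = y * (x * g 0 1) /\ x * g 1 1 = - (y * g 0 0)).
  move=> x0 /gsing/singB; rewrite !cact_complex; have [n1 _] := nonreal_point x0 det.
  case=> [/(isz_complex s0) h|/(isz_complex o0) h|/eqP]; last by rewrite (negPf n1).
    by exists s; [left|].
  by exists 1; [right|].
apply: (complex_points_iso s1 t1 det); apply: pt => //.
- by rewrite /imag_family /= sing_complex2 //= complex_point_root.
- by rewrite /imag_family has_cat /= has_nseq r0 sing_complex1 //= complex_point_root orbT.
Qed.

End Families.

(** * The six families *)

Section Conclusion.
Variable R : realType.

Lemma dim_n1_cat (S S' : seq (elt R)) : dim_n1 (S ++ S') = (dim_n1 S + dim_n1 S')%N.
Proof. by elim: S => //= s S ->; rewrite addnA. Qed.

Lemma dim_n1_nseq r (s : elt R) : dim_n1 (nseq r s) = (r * (blk_rows s + blk_cols s))%N.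
Proof. by elim: r => //= r ->; rewrite mulSn. Qed.

Lemma real_family_nonsoliton r (eps : bool) m : (0 < r)%N -> m = (8 + 2 * r + 3 * eps)%N ->
  nonsoliton_family m (@real_family R r (nseq eps (Eps R 1))).
Proof.
move=> r0 mE.
have main t (t1 : 1 < t) : nonsoliton_algebra m (real_family r (nseq eps (Eps R 1)) t).
  have t0 : t != 0 by rewrite gt_eqF // (lt_trans ltr01).
  apply: (@double_root_nonsoliton R m [:: Pair (0 +i* t)%C 1] (Pair 0 2)
    (nseq r (Pair 1 1)) eps t (double_root_real R)).
  - by rewrite /= all_nseq orbT.
  - exact: (@simple_root_pencil _ [::] (Pair (0 +i* t)%C 1) _ _ (simple_root_blk t0)).
  - rewrite dim_n1_cat /= !dim_n1_nseq /= (negPf t0) eqxx mE; clear; lia.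
split=> [t /main[]//|s t s1 t1 /eqP st iso]; apply/st.
have [ndg _] := main t t1; apply: real_family_iso r0 s1 t1 _ ndg iso => z.
by rewrite has_nseq => /andP[_ /sing_eps1].
Qed.

Lemma imag_family_nonsoliton r (real eps : bool) m : (0 < r)%N ->
  m = (8 + 4 * r + 2 * real + 3 * eps)%N ->
  nonsoliton_family m (@imag_family R r (nseq real (Pair 0 1) ++ nseq eps (Eps R 1))).
Proof.
move=> r0 mE.
have main t (t1 : 1 < t) :
    nonsoliton_algebra m (imag_family r (nseq real (Pair 0 1) ++ nseq eps (Eps R 1)) t).
  have t0 : t != 0 by rewrite gt_eqF // (lt_trans ltr01).
  rewrite /imag_family catA.
  apply: (@double_root_nonsoliton R m [::] (Pair (0 +i* t)%C 2)
    (nseq r (Pair (0 +i* 1)%C 1) ++ nseq real (Pair 0 1)) eps 1 (double_root_complex t0)).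
  - by rewrite /= all_cat !all_nseq !orbT.
  (* The simple root is i, from one of the [r] copies of (i, 1); the root it carries the Jordan
     block. *)
  - case: r r0 {mE} => // r _.
    exact: (@simple_root_pencil _ [:: Pair (0 +i* t)%C 2] _ _ _ (simple_root_blk (oner_neq0 R))).
  - rewrite !dim_n1_cat /= dim_n1_cat !dim_n1_nseq /= (negPf t0) oner_eq0 eqxx mE; clear; lia.
split=> [t /main[]//|s t s1 t1 /eqP st iso]; apply/st.
have [ndg _] := main t t1; apply: imag_family_iso r0 s1 t1 _ ndg iso => z.
rewrite has_cat !has_nseq => /orP[/andP[_]|/andP[_ /sing_eps1//]].
by rewrite (sing_real1 0) rmorph0 mul0r => /eqP.
Qed.

Lemma eq_nonsoliton_family m (S S' : R -> seq (elt R)) :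
  S =1 S' -> nonsoliton_family m S -> nonsoliton_family m S'.
Proof. by move=> SS' [h1 h2]; split=> [t|s t]; rewrite -!SS'; [apply: h1|apply: h2]. Qed.

End Conclusion.

Theorem proposition3p7 (R : realType) (r : nat) (hr : (1 <= r)%N) :
  [/\ nonsoliton_family (8 + 2 * r)%N (fun t : R =>
        [:: Pair (0 +i* t)%C 1; Pair 0 2] ++ nseq r (Pair 1 1)),
      nonsoliton_family (11 + 2 * r)%N (fun t : R =>
        [:: Pair (0 +i* t)%C 1; Pair 0 2] ++ nseq r (Pair 1 1) ++ [:: Eps R 1]),
      nonsoliton_family (8 + 4 * r)%N (fun t : R =>
        [:: Pair (0 +i* t)%C 2] ++ nseq r (Pair (0 +i* 1)%C 1)),
      nonsoliton_family (8 + 4 * r + 5)%N (fun t : R =>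
        [:: Pair (0 +i* t)%C 2] ++ nseq r (Pair (0 +i* 1)%C 1) ++
        [:: Pair 0 1; Eps R 1]) &
      nonsoliton_family (8 + 4 * r + 2)%N (fun t : R =>
        [:: Pair (0 +i* t)%C 2] ++ nseq r (Pair (0 +i* 1)%C 1) ++ [:: Pair 0 1]) /\
      nonsoliton_family (8 + 4 * r + 3)%N (fun t : R =>
        [:: Pair (0 +i* t)%C 2] ++ nseq r (Pair (0 +i* 1)%C 1) ++ [:: Eps R 1])].
Proof.
have famA eps m := @real_family_nonsoliton R r eps m hr.
have famB real eps m := @imag_family_nonsoliton R r real eps m hr.
split; last split.
- by apply: eq_nonsoliton_family (famA false _ _); [move=> t; rewrite /real_family cats0 | lia].
- by apply: eq_nonsoliton_family (famA true _ _); [move=> t; rewrite /real_family -catA | lia].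
- by apply: eq_nonsoliton_family (famB false false _ _); [move=> t; rewrite /imag_family cats0 | lia].
- by apply: eq_nonsoliton_family (famB true true _ _); [move=> t; rewrite /imag_family -catA | lia].
- by apply: eq_nonsoliton_family (famB true false _ _); [move=> t; rewrite /imag_family -catA | lia].
- by apply: eq_nonsoliton_family (famB false true _ _); [move=> t; rewrite /imag_family -catA | lia].
Qed.
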